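(* There exists an absolute constant $c>0$ such that the following holds. Let $D\subset\mathbb{R}^2$ be a convex compact set satisfying $B\subset D\subset 2B$. For any integer $n\ge 1$ and any $\boldsymbol{x}\in D$ define $\tau_n(\boldsymbol{x}):=\boldsymbol{x}$ if $\boldsymbol{x}\in(1-2^{-4}n^{-2})D$, and otherwise $\tau_n(\boldsymbol{x}):=t\boldsymbol{x}$, where $t>0$ is the largest scalar satisfying $t\boldsymbol{x}\in(1-2^{-4}n^{-2})D$. Then for every integer $n\ge1$ and every $\boldsymbol{x}\in D$, $$c^{-1}n^{-2}L(\tau_n(\boldsymbol{x}),D)\le\lambda_n(\boldsymbol{x},D)\le c\,n^{-2}L(\tau_n(\boldsymbol{x}),D)$$ and $$c^{-1}n^{-2}U(\tau_n(\boldsymbol{x}),D)\le\lambda_n(\boldsymbol{x},D)\le c\,n^{-2}U(\tau_n(\boldsymbol{x}),D),$$ where $\lambda_n(\cdot,D)$ is the Christoffel function of $D$ and $L$, $U$ are the geometric quantities defined in the context.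
   Context: $\|\cdot\|$ is the Euclidean norm on $\mathbb{R}^2$, $B=\{\boldsymbol{x}\in\mathbb{R}^2:\|\boldsymbol{x}\|\le 1\}$, $S=[0,1]^2$, $\tfrac12 S=[0,\tfrac12]^2$, $(\boldsymbol{x})_i$ is the $i$-th coordinate of $\boldsymbol{x}$, and $sD=\{s\boldsymbol{y}:\boldsymbol{y}\in D\}$ for a scalar $s$. Christoffel function: for a compact set $D\subset\mathbb{R}^2$ with non-empty interior, let $\Pi_{n,2}$ be the space of real algebraic polynomials of total degree $\le n$ in $2$ variables. Then (with respect to Lebesgue measure on $D$) $$\lambda_n(\boldsymbol{x},D)=\min_{f\in\Pi_{n,2},\,|f(\boldsymbol{x})|=1}\int_D f(\boldsymbol{y})^2\,d\boldsymbol{y},\quad \boldsymbol{x}\in D;$$ equivalently $\lambda_n(\boldsymbol{x},D)=\bigl(\sum_j p_j(\boldsymbol{x})^2\bigr)^{-1}$ for any basis $\{p_j\}$ of $\Pi_{n,2}$ orthonormal in $L^2(D)$. Geometric quantities: $\mathbb{A}$ is the collection of all non-degenerate affine transforms of $\mathbb{R}^2$, i.e. maps $\mathcal{T}(\cdot)=\boldsymbol{z}+A\,\cdot$ with $\boldsymbol{z}\in\mathbb{R}^2$ and $A$ an invertible real $2\times 2$ matrix; $\det\mathcal{T}:=\det A$. For a convex compact $D\subset\mathbb{R}^2$ with non-empty interior and $\boldsymbol{x}$ in the interior of $D$, $$L(\boldsymbol{x},D):=\sup\{(1-\|\mathcal{L}^{-1}\boldsymbol{x}\|)^{1/2}\,|\det\mathcal{L}|:\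 \mathcal{L}\in\mathbb{A},\ \boldsymbol{x}\in\mathcal{L}B\subset D\},$$ $$U(\boldsymbol{x},D):=\inf\{((\mathcal{U}^{-1}\boldsymbol{x})_1(\mathcal{U}^{-1}\boldsymbol{x})_2)^{1/2}\,|\det\mathcal{U}|:\ \mathcal{U}\in\mathbb{A},\ \boldsymbol{x}\in\mathcal{U}(\tfrac12 S),\ D\subset\mathcal{U}S\}.$$ *)

(* Defs.v *)
From mathcomp Require Import all_boot all_order all_algebra.
From mathcomp Require Import all_classical all_reals all_analysis.
(* The notations of mpoly clash with those of mathcomp-analysis. *)
From mathcomp.multinomials Require Import -(notations) mpoly.

Set Implicit Arguments.
Unset Strict Implicit.
Unset Printing Implicit Defensive.

Import Order.TTheory GRing.Theory Num.Theory.
Import numFieldNormedType.Exports.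

Local Open Scope classical_set_scope.
Local Open Scope ring_scope.

(* The norm that the libraries put on matrices is the max norm. Its topology, *)
(* hence compactness, is the Euclidean one.                                   *)
Definition enorm (R : realType) (x : 'cV[R]_2) : R :=
  Num.sqrt (\sum_(i < 2) x i 0 ^+ 2).

Definition disk (R : realType) : set 'cV[R]_2 := [set x | enorm x <= 1].
Arguments disk R : clear implicits.

(* [0, s]^2 *)
Definition square (R : realType) (s : R) : set 'cV[R]_2 :=
  [set x | forall i, 0 <= x i 0 <= s].

Definition dilate (R : realType) (s : R) (D : set 'cV[R]_2) : set 'cV[R]_2 :=
  [set s *: y | y in D].

(* Column vectors carry no measure in the library: Lebesgue measure on R^2 is *)
(* the product measure on R * R, transported along this bijection.            *)
Definition vec2 (R : realType) (p : R * R) : 'cV[R]_2 :=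
  \col_i (if i == 0 then p.1 else p.2).
Arguments vec2 {R} p.

Definition integral2 (R : realType) (D : set 'cV[R]_2) (f : 'cV[R]_2 -> R) : R :=
  \int[(lebesgue_measure \x lebesgue_measure)%E]_(p in vec2 @^-1` D) f (vec2 p).

Definition mpeval (R : realType) (f : mpoly 2 R) (x : 'cV[R]_2) : R :=
  meval (fun i => x i 0) f.

(* mpoly.msize f is 1 + the total degree of f, and 0 for f = 0. The infimum   *)
(* is attained when D is compact with non-empty interior.                     *)
Definition christoffel (R : realType) (n : nat) (x : 'cV[R]_2)
    (D : set 'cV[R]_2) : R :=
  inf [set v | exists f : mpoly 2 R,
        [/\ (mpoly.msize f <= n.+1)%N, `|mpeval f x| = 1
          & v = integral2 D (fun y => mpeval f y ^+ 2)]].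

(* The affine transform y |-> z + A y, and its inverse when A is invertible.  *)
Definition affine (R : realType) (z : 'cV[R]_2) (A : 'M[R]_2) (y : 'cV[R]_2) :
  'cV[R]_2 := z + A *m y.

Definition affine_inv (R : realType) (z : 'cV[R]_2) (A : 'M[R]_2)
  (x : 'cV[R]_2) : 'cV[R]_2 := invmx A *m (x - z).

Lemma affineK (R : realType) (z : 'cV[R]_2) (A : 'M[R]_2) :
  A \in unitmx -> cancel (affine z A) (affine_inv z A).
Proof. by move=> uA y; rewrite /affine_inv /affine addrC addKr mulKmx. Qed.

Lemma affine_invK (R : realType) (z : 'cV[R]_2) (A : 'M[R]_2) :
  A \in unitmx -> cancel (affine_inv z A) (affine z A).
Proof. by move=> uA y; rewrite /affine_inv /affine mulKVmx// addrC subrK. Qed.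

Definition geomL (R : realType) (x : 'cV[R]_2) (D : set 'cV[R]_2) : R :=
  sup [set v | exists (z : 'cV[R]_2) (A : 'M[R]_2),
        [/\ A \in unitmx, (affine z A @` disk R) x, affine z A @` disk R `<=` D
          & v = Num.sqrt (1 - enorm (affine_inv z A x)) * `|\det A|]].

Definition geomU (R : realType) (x : 'cV[R]_2) (D : set 'cV[R]_2) : R :=
  inf [set v | exists (z : 'cV[R]_2) (A : 'M[R]_2),
        [/\ A \in unitmx, (affine z A @` square 2^-1) x,
            D `<=` affine z A @` square 1
          & v = Num.sqrt (affine_inv z A x 0 0 * affine_inv z A x 1 0)
                * `|\det A|]].

(* The supremum is a maximum when D is compact, contains the unit disk, n > 0 *)
(* and x is outside the dilate of D (so that x != 0).                         *)
Definition tau (R : realType) (n : nat) (D : set 'cV[R]_2) (x : 'cV[R]_2) :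
    'cV[R]_2 :=
  let Dn := dilate (1 - 2 ^- 4 * n%:R ^- 2) D in
  if `[< Dn x >] then x else sup [set t : R | 0 < t /\ Dn (t *: x)] *: x.

(* Main.v *)
(* The theorem follows from three one-sided estimates: [v <= C n^2 lambda] for every ellipse
   value [v] of L, [lambda <= C n^-2 v] for every parallelogram value [v] of U, and
   [U <= C v] for one well chosen ellipse.

   Ellipses: the map [(u, s) |-> (u - s^2, s)] has Jacobian 1, sends a rectangle
   into the disk and the point [(r, 0)] to itself, and keeps polynomials
   polynomial, so the disk reduces to the one dimensional inequality
   [p(t)^2 sqrt(1 - t) <= C n \int p^2], applied along [u] at [r] and along [s] at
   [0].  That inequality follows from the orthogonality of the cosines applied to
   [p m], where [m] is a polynomial of degree about [1 / arccos t] with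
   [m(cos th)^2 <= C deg(m) sin th] and [m(t)] bounded below; very close to [1], and
   on the ray from [tau x] to [x], Chebyshev's extremal property extends it.

   Parallelograms: the test polynomial is a product of two one dimensional peaks
   built from [sin((2k + 1) t) / sin t].

   Comparison of U and L: if [k(m)] is the distance from [x] to the supporting line
   with normal [m], two supporting lines give [U |m x m'| <= 8 sqrt(k(m) k(m'))].
   With [m0] almost minimizing [k] this bounds [k] from below by a quadratic form,
   which is what an ellipse centred on the segment [0, x] needs in order to fit in
   [D], by comparing support functions. *)

Require Import Defs.
From mathcomp Require Import all_boot all_order all_algebra.
From mathcomp Require Import all_classical all_reals all_analysis.
From mathcomp Require Import measurable_realfun ring lra zify.
From mathcomp.multinomials Require Import -(notations) mpoly.
Import Order.TTheory GRing.Theory Num.Theory.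
Import numFieldNormedType.Exports.

Set Implicit Arguments.
Unset Strict Implicit.
Unset Printing Implicit Defensive.

Local Open Scope classical_set_scope.
Local Open Scope ring_scope.

(** * One dimensional inequalities *)

(** Why the multiplier [m]: orthogonality alone bounds [p(t)^2] by [C n] times the integral of
    [p(cos th)^2 dth], and [dth = du / sin th] is not controlled by Lebesgue measure at the
    endpoints. The factor [m^2 <= C deg(m) sin th] repays this weight; the price [deg(m)], about
    [1 / sqrt(1 - t)], is exactly the square root in the claim. Why [tau]: [n^-2] is the scale below
    which degree [n] does not see the boundary. A polynomial of degree [n] grows by a bounded factor
    over that distance outside an interval, and a peak of degree [n] at an endpoint has width
    [n^-2]. The point [tau x] keeps a relative distance [2^-4 n^-2] from every supporting line
    ([deep]), so values can be carried from [tau x] to [x], and the [n^-2] part of the mass of a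
    peak is absorbed by the square root of the distance. One dimensional integrals appear first as
    differences [P.[b] - P.[a]] of a polynomial primitive of [p ^+ 2], so the inequalities on the
    line only need the sign of a derivative. *)

Lemma le_of_is_derive_ge0 (R : realType) (f df : R -> R) (a b : R) :
  a <= b -> (forall x, a <= x <= b -> is_derive x (1 : R) f (df x)) ->
  (forall x, a <= x <= b -> 0 <= df x) -> f a <= f b.
Proof.
move=> ab fdf df0.
have df1 x : a <= x <= b -> derive1 f x = df x.
  by move=> axb; rewrite derive1E; apply: (@derive_val _ _ _ _ _ _ _ (fdf x axb)).
have dfx x : a <= x <= b -> derivable f x 1.
  by move=> axb; apply: (@ex_derive _ _ _ _ _ _ _ (fdf x axb)).
apply: (@ger0_derive1_le_cc R f a b) => //; rewrite ?in_itv/= ?lexx ?ab//.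
- by move=> x; rewrite in_itv/= => /andP[ax xb]; apply: dfx; rewrite !ltW.
- move=> x; rewrite in_itv/= => /andP[ax xb].
  have axb : a <= x <= b by rewrite !ltW.
  by rewrite df1// df0.
- by apply: derivable_within_continuous => x; rewrite in_itv/=; exact: dfx.
Qed.

(** * Cosine sums and their mean square *)

Definition cos_sum (R : realType) (m : nat) (a : nat -> R) (t : R) : R :=
  \sum_(k < m) a k * cos (k%:R * t).

Lemma cos_sumD (R : realType) (m : nat) (a b : nat -> R) (t : R) :
  cos_sum m a t + cos_sum m b t = cos_sum m (fun k => a k + b k) t.
Proof. by rewrite -big_split; apply: eq_bigr => k _ /=; rewrite mulrDl. Qed.

Lemma cos_sumZ (R : realType) (m : nat) (c : R) (a : nat -> R) (t : R) :
  c * cos_sum m a t = cos_sum m (fun k => c * a k) t.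
Proof. by rewrite /cos_sum mulr_sumr; apply: eq_bigr => k _ /=; rewrite mulrA. Qed.

Lemma cos_sum_single (R : realType) (m j : nat) (t : R) : (j < m)%N ->
  cos (j%:R * t) = cos_sum m (fun k => (k == j)%:R) t.
Proof.
move=> jm; rewrite /cos_sum (bigD1 (Ordinal jm))//= eqxx mul1r big1 ?addr0//.
by move=> i ij; rewrite -val_eqE /= in ij; rewrite (negPf ij) mul0r.
Qed.

Lemma cos_sum_sum (R : realType) (m n : nat) (f : nat -> R -> R) :
  (forall k, (k < n)%N -> exists a, forall t, f k t = cos_sum m a t) ->
  exists a, forall t, \sum_(k < n) f k t = cos_sum m a t.
Proof.
elim: n => [_|n IH H].
  exists (fun=> 0) => t; rewrite big_ord0 /cos_sum big1// => k _.
  by rewrite mul0r.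
have [k kn|a aE] := IH; first by apply: H; rewrite ltnS ltnW.
have [b bE] := H n (ltnSn n).
exists (fun k => a k + b k) => t.
by rewrite big_ord_recr /= aE bE cos_sumD.
Qed.

Lemma cos_mul_cos_sum (R : realType) (m : nat) (a : nat -> R) :
  exists b, forall t, cos t * cos_sum m a t = cos_sum m.+1 b t.
Proof.
have [k km|b bE] := @cos_sum_sum _ m.+1 m (fun k t => cos t * (a k * cos (k%:R * t))).
  case: k km => [|k] km.
    exists (fun i => a 0%N * (i == 1%N)%:R) => t.
    by rewrite -cos_sumZ -cos_sum_single ?ltnS// mul0r cos0 mul1r; ring.
  exists (fun i => a k.+1 / 2 * ((i == k.+2)%:R + (i == k)%:R)) => t.
  rewrite -cos_sumZ -cos_sumD -!cos_sum_single ?ltnS//; last by lia.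
  have -> : (k.+2%:R * t : R) = k.+1%:R * t + t by rewrite -[in LHS]natr1; ring.
  have -> : (k%:R * t : R) = k.+1%:R * t - t by rewrite -[in RHS]natr1; ring.
  by rewrite cosD cosB; field.
by exists b => t; rewrite -bE /cos_sum mulr_sumr.
Qed.

Lemma horner_cos (R : realType) (m : nat) (p : {poly R}) : (size p <= m)%N ->
  exists a, forall t, p.[cos t] = cos_sum m a t.
Proof.
elim: m p => [|m IH] p.
  rewrite leqn0 size_poly_eq0 => /eqP ->; exists (fun=> 0) => t.
  by rewrite horner0 /cos_sum big_ord0.
elim/poly_ind: p => [|p c _] sp.
  exists (fun=> 0) => t; rewrite horner0 /cos_sum big1// => k _.
  by rewrite mul0r.
have /IH[a aE] : (size p <= m)%N.
  have [->|p0] := eqVneq p 0; first by rewrite size_poly0.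
  by move: sp; rewrite -cons_poly_def size_cons_poly nil_poly (negPf p0) /=.
have [b bE] := @cos_mul_cos_sum _ m a.
exists (fun k => b k + c * (k == 0%N)%:R) => t.
by rewrite -cos_sumD -cos_sumZ -cos_sum_single// mul0r cos0 mulr1 -bE !hornerE aE mulrC.
Qed.

(** Cauchy-Schwarz against the constant 1, from [x_i x_j <= (x_i^2 + x_j^2) / 2] summed over all
    pairs. *)
Lemma sqr_sum_le (R : realFieldType) (m : nat) (x : 'I_m -> R) :
  (\sum_i x i) ^+ 2 <= m%:R * \sum_i x i ^+ 2.
Proof.
rewrite expr2 mulr_suml.
have -> : m%:R * \sum_i x i ^+ 2 =
    \sum_i \sum_j (x i ^+ 2 / 2 + x j ^+ 2 / 2).
  rewrite [RHS](eq_bigr (fun i => m%:R * x i ^+ 2 / 2 + (\sum_j x j ^+ 2) / 2)).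
    rewrite big_split /= sumr_const card_ord -!mulr_suml -mulr_sumr -[_ *+ m]mulr_natl.
    by field.
  move=> i _; rewrite big_split /= sumr_const card_ord -mulr_suml -[_ *+ m]mulr_natl.
  by rewrite mulrA.
apply: ler_sum => i _; rewrite mulr_sumr; apply: ler_sum => j _.
rewrite -subr_ge0.
have -> : x i ^+ 2 / 2 + x j ^+ 2 / 2 - x i * x j = (x i - x j) ^+ 2 / 2 by field.
by rewrite divr_ge0 ?sqr_ge0.
Qed.

(** The frequency 0 is separate because [sin 0 / 0] would evaluate to 0 instead of [t]. *)
Definition cos_primitive (R : realType) (c t : R) : R :=
  if c == 0 then t else sin (c * t) / c.

Lemma is_derive_cos_primitive (R : realType) (c t : R) :
  is_derive t (1 : R) (cos_primitive c) (cos (c * t)).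
Proof.
rewrite /cos_primitive; have [->|c0] := eqVneq c 0.
  by rewrite mul0r cos0; apply: is_derive_id.
have H : is_derive t (1 : R) (fun t => c * t) c.
  by apply: is_derive_eq; rewrite /GRing.scale /= mulr1.
have := @is_derive1_comp R sin (fun t => c * t) t _ _ (is_derive_sin (c * t)) H.
move=> H2; have -> : (fun t => sin (c * t) / c) = c^-1 *: (sin \o ( *%R c)).
  by apply/funext => u; rewrite [RHS]mulrC.
by apply: is_derive_eq; rewrite /GRing.scale /=; field.
Qed.

Lemma sin_nat_pi (R : realType) (n : nat) : sin (n%:R * pi) = 0 :> R.
Proof.
elim: n => [|n IH]; first by rewrite mul0r sin0.
by rewrite -natr1 mulrDl mul1r sinD IH sinpi mul0r mulr0 addr0.
Qed.

Lemma cos_primitive_pi (R : realType) (j k : nat) :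
  (cos_primitive (j%:R - k%:R : R) pi = if j == k then pi else 0) /\
  (cos_primitive (j%:R + k%:R : R) pi = if (j + k == 0)%N then pi else 0).
Proof.
rewrite /cos_primitive subr_eq0 eqr_nat -natrD pnatr_eq0; split; case: ifP => // _.
  by rewrite mulrBl sinB !sin_nat_pi mul0r mulr0 subrr mul0r.
by rewrite sin_nat_pi mul0r.
Qed.

Lemma cos_primitive0 (R : realType) (c : R) : cos_primitive c 0 = 0.
Proof. by rewrite /cos_primitive mulr0 sin0 mul0r if_same. Qed.

(* Orthogonality of the cosines, and Cauchy-Schwarz. *)
Lemma horner_cos_sqr_le (R : realType) (m : nat) (p : {poly R}) : (size p <= m)%N ->
  exists2 G : R -> R, (forall t, is_derive t (1 : R) G (p.[cos t] ^+ 2)) &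
    forall t, pi / 2 * p.[cos t] ^+ 2 <= m%:R * (G pi - G 0).
Proof.
move=> /horner_cos[a aE].
(* The square is expanded by the product-to-sum formula and integrated term by term. *)
pose G := \sum_(j < m) \sum_(k < m) (a j * a k / 2) *:
  (cos_primitive (j%:R - k%:R) + cos_primitive (j%:R + k%:R)).
exists G => [t|t].
  rewrite aE /cos_sum expr2 mulr_suml; under eq_bigr => j _ do rewrite mulr_sumr.
  apply: is_derive_sum => j; apply: is_derive_sum => k.
  have H1 := is_derive_cos_primitive (j%:R - k%:R) t.
  have H2 := is_derive_cos_primitive (j%:R + k%:R) t.
  by apply: is_derive_eq; rewrite mulrBl mulrDl cosB cosD /GRing.scale /=; field.
have GE s : G s = \sum_(j < m) \sum_(k < m) a j * a k / 2 *
   (cos_primitive (j%:R - k%:R) s + cos_primitive (j%:R + k%:R) s).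
  by rewrite /G fct_sumE; apply: eq_bigr => j _; rewrite fct_sumE.
have -> : G 0 = 0.
  rewrite GE big1// => j _; rewrite big1// => k _.
  by rewrite !cos_primitive0 addr0 mulr0.
rewrite subr0 GE.
apply: (@le_trans _ _ (m%:R * (pi / 2 * \sum_(j < m) a j ^+ 2))); last first.
  rewrite ler_wpM2l// mulr_sumr; apply: ler_sum => j _.
  rewrite (bigD1 j)//= big1 ?addr0 => [|k kj].
    have [-> ->] := cos_primitive_pi R j j; rewrite eqxx.
    (* The index 0 gives twice what is needed, every other index gives equality. *)
    case: ifP => _; last by rewrite addr0 [leLHS](_ : _ = a j * a j / 2 * pi)//; field.
    rewrite -subr_ge0.
    have -> : a j * a j / 2 * (pi + pi) - pi / 2 * a j ^+ 2 = pi / 2 * a j ^+ 2 by field.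
    by rewrite mulr_ge0 ?sqr_ge0// divr_ge0// pi_ge0.
  have [-> ->] := cos_primitive_pi R j k.
  rewrite -val_eqE /= eq_sym in kj; rewrite (negPf kj) ifF ?addr0 ?mulr0//; lia.
rewrite [leRHS]mulrCA ler_wpM2l ?divr_ge0 ?pi_ge0// aE.
apply: le_trans (@sqr_sum_le _ _ (fun k => a k * cos (k%:R * t))) _.
rewrite ler_wpM2l//; apply: ler_sum => j _.
by rewrite exprMn -[leRHS]mulr1 ler_wpM2l ?sqr_ge0.
Qed.

(** * Chebyshev polynomials *)

Lemma nat_ind2 (P : nat -> Prop) :
  P 0%N -> P 1%N -> (forall n, P n -> P n.+1 -> P n.+2) -> forall n, P n.
Proof.
move=> P0 P1 PS n; have [//] : P n /\ P n.+1.
by elim: n => [//|n [Pn PSn]]; split=> //; apply: PS.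
Qed.

(** The pair is [(T_n, T_(n+1))], which makes the two-step recurrence structural. *)
Fixpoint chebyshev (R : realType) (n : nat) : {poly R} * {poly R} :=
  if n is n'.+1 then
    let: (p, q) := chebyshev R n' in (q, 2%:P * 'X * q - p)
  else (1, 'X).

Arguments chebyshev R n : clear implicits.

Lemma chebyshevSS (R : realType) (n : nat) :
  (chebyshev R n.+2).1 = 2%:P * 'X * (chebyshev R n.+1).1 - (chebyshev R n).1.
Proof. by rewrite /=; case: (chebyshev R n). Qed.

Lemma size_chebyshev (R : realType) (n : nat) :
  (size (chebyshev R n).1 <= n.+1)%N.
Proof.
elim/nat_ind2: n => [||n H0 H1]; rewrite ?size_poly1 ?size_polyX//.
rewrite chebyshevSS (leq_trans (size_polyD _ _))// geq_max size_polyN.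
apply/andP; split; last by rewrite (leq_trans H0)// ltnW.
rewrite -mulrA mul_polyC (leq_trans (size_scale_leq _ _))// mulrC.
have [->|p0] := eqVneq (chebyshev R n.+1).1 0; first by rewrite mul0r size_poly0.
by rewrite size_mulX.
Qed.

Lemma chebyshev_cos (R : realType) (n : nat) (t : R) :
  (chebyshev R n).1.[cos t] = cos (n%:R * t).
Proof.
elim/nat_ind2: n => [||n H0 H1]; rewrite ?hornerE ?mul0r ?cos0 ?mul1r//.
rewrite chebyshevSS !hornerE H0 H1.
have -> : n.+2%:R * t = n.+1%:R * t + t by rewrite -[in LHS]natr1; ring.
have -> : n%:R * t = n.+1%:R * t - t by rewrite -[in RHS]natr1; ring.
by rewrite cosB cosD; ring.
Qed.

(** The increments satisfy [d_(k+1) = d_k + 2 e T_(k+1)]. As long as the values stay below 2 an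
    increment grows by at most [4 e], and summing the increments keeps the values below
    [1 + 4 e n^2 <= 2]; the two facts are proved by one induction. *)
Lemma chebyshev_le2 (R : realType) (n : nat) (e : R) : 0 <= e ->
  e * n%:R ^+ 2 <= 1 / 4 -> (chebyshev R n).1.[1 + e] <= 2.
Proof.
move=> e0 en.
pose T k := (chebyshev R k).1.[1 + e].
have TSS k : T k.+2 = 2 * (1 + e) * T k.+1 - T k.
  by rewrite /T chebyshevSS !hornerE.
have T0 : T 0%N = 1 by rewrite /T /= hornerE.
have T1 : T 1%N = 1 + e by rewrite /T /= hornerE.
have key k : (k < n)%N ->
    [/\ T k <= 2, T k.+1 <= 2, T k.+1 - T k <= 4 * e * k.+1%:R &
        T k.+1 <= 1 + 4 * e * k.+1%:R ^+ 2].
  elim: k => [n0|k IH kn].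
    have n1 : 1 <= n%:R ^+ 2 :> R by rewrite expr_ge1// ler1n.
    have e4 : e <= 1 / 4 by nra.
    by split; rewrite ?T0 ?T1 ?expr1n; lra.
  have [h1 h2 h3 h4] := IH (ltnW kn).
  have kn2 : (k.+2)%:R ^+ 2 <= n%:R ^+ 2 :> R by rewrite ler_sqr ?nnegrE// ler_nat.
  have E2 : k.+2%:R = k.+1%:R + 1 :> R by rewrite natr1.
  have k0 : 0 <= k.+1%:R :> R by [].
  have hd : T k.+2 - T k.+1 <= 4 * e * k.+2%:R by rewrite TSS E2; nra.
  have h5 : T k.+2 <= 1 + 4 * e * k.+2%:R ^+ 2.
    by rewrite E2 in hd *; nra.
  by split=> //; nra.
case: n en key => [|n] en key; first by rewrite /= hornerE; lra.
by have [] := key n (ltnSn n).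
Qed.

(** * Extremal growth outside an interval *)

Section Extrapolation.
Variables (R : realType) (n : nat).
Hypothesis n_gt0 : (0 < n)%N.

(* The Chebyshev nodes; the tail makes the sequence injective on all of nat. *)
Let node (j : nat) : R := if (j <= n)%N then cos (j%:R / n%:R * pi) else j.+2%:R.

Let angle_itv j : (j <= n)%N -> (j%:R / n%:R * pi : R) \in `[0, pi].
Proof.
move=> jn; rewrite in_itv/= mulr_ge0 ?divr_ge0 ?pi_ge0//=.
by rewrite ler_piMl ?pi_ge0// ler_pdivrMr ?ltr0n// mul1r ler_nat.
Qed.

Let node_lt j k : (j < k)%N -> (k <= n)%N -> node k < node j.
Proof.
move=> jk kn; rewrite /node kn (leq_trans (ltnW jk) kn).
rewrite ltr_cos ?angle_itv ?(leq_trans (ltnW jk) kn)//.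
by rewrite ltr_pM2r ?pi_gt0// ltr_pM2r ?invr_gt0 ?ltr0n// ltr_nat.
Qed.

Let node_le1 j : (j <= n)%N -> -1 <= node j <= 1.
Proof. by move=> jn; rewrite /node jn cos_geN1 cos_le1. Qed.

Let node_inj : injective node.
Proof.
have H j k : (j < k)%N -> node j <> node k.
  move=> jk E; have [kn|kn] := leqP k n.
    by have := node_lt jk kn; rewrite E ltxx.
  have [jn|jn] := leqP j n.
    have := node_le1 jn; rewrite E /node leqNgt kn /= => /andP[_].
    by rewrite (_ : 1 = 1%:R)// ler_nat; lia.
  move: E; rewrite /node leqNgt jn leqNgt kn /= => /eqP.
  by rewrite eqr_nat; lia.
move=> j k E; case: (ltngtP j k) => // jk; [by case: (H _ _ jk)|].
by case: (H _ _ jk).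
Qed.

Let chebyshev_node j : (j <= n)%N -> (chebyshev R n).1.[node j] = (-1) ^+ j.
Proof.
move=> jn; rewrite /node jn chebyshev_cos.
have -> : n%:R * (j%:R / n%:R * pi) = j%:R * pi :> R.
  by field; rewrite pnatr_eq0 -lt0n.
elim: j {jn} => [|j IH]; first by rewrite mul0r cos0 expr0.
by rewrite -natr1 mulrDl mul1r cosD cospi sinpi mulr0 subr0 IH exprSr.
Qed.

Let interp (j : 'I_n.+1) : {poly R} := tnth (lagrange n.+1 node) j.

(** To the right of all nodes only the [j] denominators [node j - node k] with [k < j] are
    negative. *)
Let interp_sign (x : R) (j : 'I_n.+1) : 1 <= x -> 0 <= (-1) ^+ j * (interp j).[x].
Proof.
move=> x1; rewrite /interp lagrangeE// hornerM hornerC !horner_prod -prodfV -big_split /=.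
have -> : (-1) ^+ j = \prod_(k < n.+1 | k != j) (if (k < j)%N then -1 else 1) :> R.
  rewrite -[LHS]mulr1 -[in LHS](card_ord j) -prodr_const.
  rewrite (big_ord_widen n.+1 (fun=> -1)) ?(ltnW (ltn_ord j))// mulr1.
  rewrite big_mkcond [RHS]big_mkcond /=; apply: eq_bigr => k _.
  by case: (ltngtP k j) => //= kj; rewrite -val_eqE /= ?kj ?eqxx ?(gtn_eqF kj) ?(ltn_eqF kj).
rewrite -big_split /=; apply: prodr_ge0 => k kj.
rewrite hornerXsubC hornerXsubC.
have xk : 0 <= x - node k.
  rewrite subr_ge0 (le_trans _ x1)//.
  by have := node_le1 (ltn_ord k : (k <= n)%N) => /andP[].
rewrite mulrA mulr_ge0//; case: ltngtP kj => kj; rewrite -val_eqE /= ?kj ?eqxx// => _.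
  by rewrite mulN1r oppr_ge0 invr_le0 subr_le0 ltW// node_lt// -ltnS.
by rewrite mul1r invr_ge0 subr_ge0 ltW// node_lt// -ltnS.
Qed.

(** Lagrange interpolation at the nodes: [T_n] takes the values [(-1)^j] there, the same signs as
    the basis polynomials at [x], so [T_n(x)] is the sum of their absolute values. *)
Lemma horner_le_chebyshev (p : {poly R}) (M x : R) : (size p <= n.+1)%N ->
  (forall t, -1 <= t <= 1 -> `|p.[t]| <= M) -> 1 <= x ->
  `|p.[x]| <= M * (chebyshev R n).1.[x].
Proof.
move=> sp pM x1.
rewrite [in leLHS](lagrange_gen (ltn0Sn n) node_inj sp).
rewrite [in leRHS](lagrange_gen (ltn0Sn n) node_inj (size_chebyshev R n)).
rewrite !horner_sum mulr_sumr (le_trans (ler_norm_sum _ _ _))//.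
apply: ler_sum => j _.
have jn : (j <= n)%N by rewrite -ltnS.
rewrite !hornerM !hornerC chebyshev_node// normrM.
have s0 := interp_sign j x1.
have -> : `|(interp j).[x]| = (-1) ^+ j * (interp j).[x].
  by rewrite -(ger0_norm s0) normrM normrX normrN1 expr1n mul1r.
by rewrite ler_wpM2r// pM// node_le1.
Qed.

End Extrapolation.

(** After rescaling [[a, b]] to [[-1, 1]], the point [x] becomes [1 + e] with [e n^2 <= 1/4], the
    range of [chebyshev_le2]. *)
Lemma extrapolate (R : realType) (n : nat) (p : {poly R}) (M a b x : R) :
  (0 < n)%N -> (size p <= n.+1)%N -> a < b ->
  (forall t, a <= t <= b -> `|p.[t]| <= M) ->
  b <= x -> 8 * (x - b) * n%:R ^+ 2 <= b - a -> `|p.[x]| <= 2 * M.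
Proof.
move=> n0 sp ab pM bx xn.
pose r := (b - a) / 2; pose q := p \Po (r *: 'X + ((a + b) / 2)%:P).
have r0 : 0 < r by rewrite divr_gt0 ?subr_gt0.
have qE t : q.[t] = p.[r * t + (a + b) / 2] by rewrite horner_comp !hornerE.
have M0 : 0 <= M by rewrite (le_trans (normr_ge0 p.[a]))// pM// lexx ltW.
have sq : (size q <= n.+1)%N.
  rewrite size_comp_poly2// size_polyDl size_scale ?size_polyX ?gt_eqF//.
  by rewrite (leq_ltn_trans (size_polyC_leq1 _)).
pose e := (x - b) / r.
have e0 : 0 <= e by rewrite divr_ge0// ?subr_ge0// ltW.
have en : e * n%:R ^+ 2 <= 1 / 4.
  by rewrite /e mulrAC ler_pdivrMr// /r; lra.
have -> : p.[x] = q.[1 + e].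
  by rewrite qE; congr horner; rewrite /e /r; field; rewrite gt_eqF// subr_gt0.
have qM t : -1 <= t <= 1 -> `|q.[t]| <= M.
  by move=> /andP[t1 t2]; rewrite qE pM// /r; apply/andP; split; nra.
rewrite (le_trans (@horner_le_chebyshev R n n0 q M (1 + e) sq qM _))//; first lra.
by rewrite mulrC ler_wpM2r// chebyshev_le2.
Qed.

(** * The weighted pointwise bound on an interval *)

Lemma sin_le_id (R : realType) (x : R) : 0 <= x -> sin x <= x.
Proof.
move=> x0.
have H t : is_derive t (1 : R) (fun u => u - sin u) (1 - cos t).
  by apply: is_derive_eq.
have := @le_of_is_derive_ge0 R (fun u => u - sin u) _ _ _ x0 (fun t _ => H t).
rewrite sin0 subr0 => /(_ _); rewrite -subr_ge0 subr0 subr_ge0; apply.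
by move=> t _; rewrite subr_ge0 cos_le1.
Qed.

Lemma norm_sin_mul_le (R : realType) (n : nat) (x : R) :
  `|sin (n%:R * x)| <= n%:R * `|sin x|.
Proof.
elim: n => [|n IH]; first by rewrite !mul0r sin0 normr0.
rewrite -natr1 !mulrDl !mul1r sinD (le_trans (ler_normD _ _))// !normrM lerD//.
  by rewrite (le_trans _ IH)// ler_piMr// cos_max.
by rewrite ler_piMl// cos_max.
Qed.

Lemma cos_ge_quadratic (R : realType) (x : R) : 0 <= x -> 2 * (1 - cos x) <= x ^+ 2.
Proof.
move=> x0.
have H t : is_derive t (1 : R) (fun u => u ^+ 2 + 2 * cos u) (2 * (t - sin t)).
  apply: is_derive_eq; rewrite /GRing.scale /=; ring.
have := @le_of_is_derive_ge0 R _ _ _ _ x0 (fun t _ => H t).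
rewrite cos0 expr0n /= => h; have {h} : 0 + 2 * 1 <= x ^+ 2 + 2 * cos x; last by lra.
apply: h.
by move=> t /andP[t0 _]; have := sin_le_id t0; lra.
Qed.

(* Half angles: [sin^4 (N t / 2) cos^4 (t / 2)] is at most [N sin (t / 2) cos (t / 2)]. *)
Lemma chebyshev_minorant (R : realType) (N : nat) (t : R) : 0 <= t <= pi ->
  ((1 - cos (N%:R * t)) * (1 + cos t)) ^+ 2 <= 8 * N%:R * sin t.
Proof.
move=> /andP[t0 tpi]; pose a := t / 2.
have tE : t = a *+ 2 by rewrite mulr2n /a; field.
have NtE : N%:R * t = (N%:R * a) *+ 2 by rewrite mulr2n /a; field.
have a0 : 0 <= a <= pi / 2 by rewrite /a; lra.
have c0 : 0 <= cos a by rewrite cos_ge0_pihalf//; lra.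
have s0 : 0 <= sin a by rewrite sin_ge0_pi//; have := pi_ge0 R; lra.
have h := norm_sin_mul_le N a; rewrite (ger0_norm s0) in h.
rewrite NtE tE cos_mulr2n sin_mulr2n.
have -> : 1 - (cos (N%:R * a) ^+ 2 *+ 2 - 1) = 2 * `|sin (N%:R * a)| ^+ 2.
  by rewrite real_normK ?num_real// sin2cos2 mulr2n; ring.
rewrite cos_mulr2n [1 + _](_ : _ = 2 * cos a ^+ 2); last by rewrite mulr2n; ring.
have S1 : `|sin (N%:R * a)| <= 1 by exact: sin_max.
have c1 := cos_le1 a.
set S := `| _ | in h S1 *; have S0 : 0 <= S by exact: normr_ge0.
have -> : (2 * S ^+ 2 * (2 * cos a ^+ 2)) ^+ 2 = 16 * (S ^+ 4 * cos a ^+ 4) by ring.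
have S4 : S ^+ 4 <= S by rewrite -[leRHS]expr1 ler_wiXn2l.
have c4 : cos a ^+ 4 <= cos a by rewrite -[leRHS]expr1 ler_wiXn2l.
have := ler_pM (exprn_ge0 4 S0) (exprn_ge0 4 c0) (le_trans S4 h) c4.
by rewrite mulr2n; lra.
Qed.

(** [N] is the least integer above [pi / (2 t)]. It makes [1 - cos (N t) >= 1] at the point of
    interest while [N] stays of order [1 / t]. *)
Lemma exists_cos_le0 (R : realType) (t : R) : 0 < t <= pi ->
  exists N : nat, [/\ (0 < N)%N, N%:R * t <= pi & cos (N%:R * t) <= 0].
Proof.
move=> /andP[t0 tpi]; pose y := pi / 2 / t.
have y0 : 0 <= y by rewrite !divr_ge0 ?pi_ge0// ltW.
have yt : y * t = pi / 2 by rewrite /y divfK// gt_eqF.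
have y1 : (Num.truncn y)%:R <= y by rewrite truncn_le.
have y2 : y < (Num.truncn y).+1%:R by rewrite -truncn_le_nat.
have h1 : pi / 2 <= (Num.truncn y).+1%:R * t by rewrite -yt ler_pM2r// ltW.
have h2 : (Num.truncn y).+1%:R * t <= pi.
  have [tp|tp] := leP t (pi / 2); first by rewrite -natr1; nra.
  have -> : Num.truncn y = 0%N.
    apply/eqP; rewrite -leqn0 truncn_le_nat /y ltr_pdivrMr// mul1r; exact: tp.
  by rewrite mul1r.
exists (Num.truncn y).+1; split=> //; rewrite -(@cos_pihalf R).
have p0 := @pi_gt0 R.
have [<-//|ne] := eqVneq (pi / 2) ((Num.truncn y).+1%:R * t).
rewrite ltW// ltr_cos ?in_itv/=; first by rewrite lt_neqAle ne h1.
  by apply/andP; split; lra.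
by apply/andP; split; lra.
Qed.

(** The substitution [u = cos t], carried out on primitives: the factor [sin t] allowed by the bound
    on [m] turns [dt] into [du]. *)
Lemma primitive_cos_le (R : realType) (p P : {poly R}) (G : R -> R) (m : {poly R}) (K : R) :
  P^`() = p ^+ 2 -> (forall t, is_derive t (1 : R) G ((p * m).[cos t] ^+ 2)) ->
  (forall t, 0 <= t <= pi -> m.[cos t] ^+ 2 <= K * sin t) ->
  G pi - G 0 <= K * (P.[1] - P.[-1]).
Proof.
move=> Pp Gd mK.
have H t : is_derive t (1 : R) (fun u => - K * P.[cos u] - G u)
    (K * (p.[cos t] ^+ 2 * sin t) - (p * m).[cos t] ^+ 2).
  have H1 := @is_derive1_comp R (horner P) cos t _ _ (is_derive_poly P (cos t)) (is_derive_cos t).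
  rewrite (_ : (fun u => _) = (- K) *: (horner P \o cos) - G)//.
  apply: is_derive_eq; rewrite Pp !hornerE /GRing.scale /=; ring.
have := @le_of_is_derive_ge0 R _ _ _ _ (pi_ge0 R) (fun t _ => H t).
rewrite cos0 cospi => h.
have {h} : - K * P.[1] - G 0 <= - K * P.[-1] - G pi; last by lra.
apply: h => t tpi; rewrite hornerM exprMn subr_ge0 [leRHS]mulrCA ler_wpM2l ?sqr_ge0//.
exact: mK.
Qed.

Lemma horner_sqr_le_interior (R : realType) (n : nat) (p P : {poly R}) (t : R) :
  (0 < n)%N -> (size p <= n.+1)%N -> P^`() = p ^+ 2 ->
  - (1 / 3) <= t < 1 -> 1 <= 32 * n%:R ^+ 2 * (1 - t) ->
  p.[t] ^+ 2 * Num.sqrt (1 - t) <= 1026 * n%:R * (P.[1] - P.[-1]).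
Proof.
move=> n0 sp Pp /andP[t1 t2] nt.
have t_itv : -1 <= t <= 1 by lra.
have acos_t : cos (acos t) = t by rewrite acosK// in_itv.
have th0 : 0 < acos t <= pi by rewrite acos_gt0 ?acos_lepi//; lra.
have [N [N0 Npi Ncos]] := exists_cos_le0 th0.
(* The first factor vanishes at [u = 1] and is at least 1 at [t]. The second one vanishes at
   [u = -1], where [sin] vanishes too, and is at least 2/3 because [t >= -1/3]. *)
pose m := (1 - (chebyshev R N).1) * (1 + 'X).
have mE s : m.[cos s] = (1 - cos (N%:R * s)) * (1 + cos s).
  by rewrite /m !hornerE chebyshev_cos.
have mt : 2 / 3 <= m.[t] by rewrite -acos_t mE acos_t; nra.
have sm : (size m <= N + 2)%N.
  rewrite (leq_trans (size_polyMleq _ _))// -subn1 leq_subLR.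
  have h1 : (size (1 - (chebyshev R N).1)%R <= N.+1)%N.
    rewrite (leq_trans (size_polyD _ _))// geq_max size_poly1 size_polyN.
    by rewrite size_chebyshev.
  have h2 : (size (1 + 'X : {poly R})%R <= 2)%N.
    by rewrite (leq_trans (size_polyD _ _))// geq_max size_poly1 size_polyX.
  by rewrite (leq_trans (leq_add h1 h2))//; lia.
have spm : (size (p * m)%R <= n + N + 2)%N.
  rewrite (leq_trans (size_polyMleq _ _))// -subn1 leq_subLR.
  by rewrite (leq_trans (leq_add sp sm))//; lia.
have [G Gd Gle] := horner_cos_sqr_le spm.
have GP : G pi - G 0 <= 8 * N%:R * (P.[1] - P.[-1]).
  by apply: primitive_cos_le Pp Gd _ => s s0; rewrite mE chebyshev_minorant.
have := Gle (acos t); rewrite acos_t hornerM exprMn => {Gle}.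
set I := _ - P.[_] in GP *; set y := p.[t] ^+ 2; move=> Gle.
have y0 : 0 <= y by exact: sqr_ge0.
have m2 : 4 / 9 <= m.[t] ^+ 2 by nra.
have ym : 4 / 9 * y <= y * m.[t] ^+ 2 by rewrite mulrC ler_wpM2l.
have pi4 : pi <= 4 :> R by have := @pihalf_lt2 R; lra.
have ym2 : 4 / 9 * y <= pi / 2 * (y * m.[t] ^+ 2).
  by rewrite (le_trans ym)// ler_peMl ?pihalf_ge1// mulr_ge0 ?sqr_ge0.
have k0 : 0 <= (n + N + 2)%:R :> R by [].
have kG : (n + N + 2)%:R * (G pi - G 0) <= (n + N + 2)%:R * (8 * N%:R * I).
  by rewrite ler_wpM2l.
have main : y <= 18 * N%:R * (n + N + 2)%:R * I by lra.
have NR : 0 < N%:R :> R by rewrite ltr0n.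
have nR : 1 <= n%:R :> R by rewrite ler1n.
pose th := acos t; have thq : 2 * (1 - t) <= th ^+ 2.
  by rewrite -[in leLHS]acos_t cos_ge_quadratic// ltW//; case/andP: th0.
have Nth : N%:R * th <= 4 by exact: le_trans Npi pi4.
have th_gt0 : 0 < th by case/andP: th0.
(* From [N th <= pi <= 4] and [2 (1 - t) <= th^2]. *)
have N2 : N%:R ^+ 2 * (1 - t) <= 8.
  have : (N%:R * th) ^+ 2 <= 4 ^+ 2 by rewrite ler_sqr ?nnegrE// mulr_ge0 ?ltW.
  by rewrite exprMn; nra.
have s0 : 0 <= Num.sqrt (1 - t) by exact: sqrtr_ge0.
have s2 : Num.sqrt (1 - t) ^+ 2 = 1 - t by rewrite sqr_sqrtr//; lra.
move: (Num.sqrt (1 - t) : R) s0 s2 => s s0 s2.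
have Ns : N%:R * s <= 3.
  rewrite -ler_sqr ?nnegrE ?mulr_ge0//; rewrite exprMn s2; lra.
(* Here the distance of [t] from 1 is used: [N^2 <= 8 / (1 - t) <= 256 n^2], so multiplying by [m]
   keeps the degree of order [n]. *)
have Nn : N%:R <= 16 * n%:R :> R.
  rewrite leNgt; apply/negP => Nn.
  have : (16 * n%:R) ^+ 2 < N%:R ^+ 2 :> R by rewrite ltr_sqr ?nnegrE ?mulr_ge0.
  have : N%:R ^+ 2 * 1 <= N%:R ^+ 2 * (32 * n%:R ^+ 2 * (1 - t)) by rewrite ler_wpM2l ?sqr_ge0.
  have : n%:R ^+ 2 * (N%:R ^+ 2 * (1 - t)) <= n%:R ^+ 2 * 8 by rewrite ler_wpM2l ?sqr_ge0.
  by lra.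
have kn : (n + N + 2)%:R <= 19 * n%:R :> R by rewrite !natrD; lra.
have I0 : 0 <= I.
  have : 0 <= 18 * N%:R * (n + N + 2)%:R * I by exact: le_trans y0 main.
  by rewrite pmulr_rge0// !mulr_gt0// ltr0n; lia.
apply: le_trans (_ : 18 * N%:R * (n + N + 2)%:R * I * s <= _); first by rewrite ler_wpM2r.
(* One factor [N] cancels the square root, [N s <= 3]; the degree is at most [19 n]. Hence
   [1026 = 18 * 3 * 19]. *)
have -> : 18 * N%:R * (n + N + 2)%:R * I * s = 18 * (N%:R * s) * ((n + N + 2)%:R * I) by ring.
apply: le_trans (_ : 18 * 3 * (19 * n%:R * I) <= _); last first.
  by rewrite (_ : 18 * 3 * (19 * n%:R * I) = 1026 * n%:R * I)//; ring.
apply: ler_pM; rewrite ?mulr_ge0// ?ler_wpM2l// ?ler_wpM2r//.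
Qed.

(** In the last stretch of length [1 / (32 n^2)] the interior bound is extrapolated. It gives [p^2]
    of order [n^2] times the integral there, and the weight, at most [1 / (5 n)], removes one power
    of [n]. *)
Lemma horner_sqr_le (R : realType) (n : nat) (p P : {poly R}) (t : R) :
  (0 < n)%N -> (size p <= n.+1)%N -> P^`() = p ^+ 2 -> - (1 / 3) <= t <= 1 ->
  p.[t] ^+ 2 * Num.sqrt (1 - t) <= 5200 * n%:R * (P.[1] - P.[-1]).
Proof.
move=> n0 sp Pp /andP[t1 t2].
have nR : 1 <= n%:R :> R by rewrite ler1n.
have I0 : 0 <= P.[1] - P.[-1].
  rewrite subr_ge0; apply: (le_of_is_derive_ge0 _ (fun x _ => is_derive_poly P x)); first lra.
  by move=> x _; rewrite Pp horner_exp sqr_ge0.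
set I := P.[1] - _ in I0 *.
have [nt|nt] := leP 1 (32 * n%:R ^+ 2 * (1 - t)).
  have t3 : t < 1.
    by rewrite lt_neqAle t2 andbT; apply/eqP => E; move: nt; rewrite E; lra.
  rewrite (le_trans (horner_sqr_le_interior n0 sp Pp _ nt)) ?t1//.
  by rewrite ler_wpM2r// ler_wpM2r//; lra.
pose b : R := 1 - (32 * n%:R ^+ 2)^-1.
have n2 : 0 < 32 * n%:R ^+ 2 :> R by nra.
have bE : 32 * n%:R ^+ 2 * (1 - b) = 1 by rewrite /b opprB addrC subrK mulfV// gt_eqF.
have b1 : 31 / 32 <= b.
  have : 1 <= n%:R ^+ 2 :> R by rewrite expr_ge1.
  by move=> ?; rewrite -(ler_pM2l n2); lra.
have bt : b <= t by rewrite -(ler_pM2l n2); lra.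
(* On [[-1/3, b]] one has [1 <= 6 n sqrt(1 - s)], and [6 * 1026 <= 6400]. *)
have [M M0 M2] : exists2 M : R, 0 <= M & M ^+ 2 = 6400 * n%:R ^+ 2 * I.
  exists (Num.sqrt (6400 * n%:R ^+ 2 * I)); first exact: sqrtr_ge0.
  apply: sqr_sqrtr; apply: mulr_ge0 I0; apply: mulr_ge0; [exact: ler0n|exact: sqr_ge0].
have pM s : - (1 / 3) <= s <= b -> `|p.[s]| <= M.
  move=> /andP[s1 s2]; rewrite -ler_sqr ?nnegrE// real_normK ?num_real// M2.
  have s2' : 32 * n%:R ^+ 2 * s <= 32 * n%:R ^+ 2 * b by rewrite ler_pM2l.
  have ns : 1 <= 32 * n%:R ^+ 2 * (1 - s) by lra.
  have s3 : s < 1 by rewrite -(ltr_pM2l n2); lra.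
  have s4 : - (1 / 3) <= s < 1 by rewrite s1.
  have h := horner_sqr_le_interior n0 sp Pp s4 ns.
  have w0 : 0 <= Num.sqrt (1 - s) by exact: sqrtr_ge0.
  have w2 : Num.sqrt (1 - s) ^+ 2 = 1 - s by rewrite sqr_sqrtr//; lra.
  move: (Num.sqrt (1 - s) : R) w0 w2 h => w w0 w2 h.
  have nw : 1 <= 6 * (n%:R * w).
    by rewrite -ler_sqr ?nnegrE ?mulr_ge0// !exprMn w2; lra.
  apply: le_trans (_ : 6 * (n%:R * w) * p.[s] ^+ 2 <= _); first by rewrite ler_peMl ?sqr_ge0.
  have : n%:R * (p.[s] ^+ 2 * w) <= n%:R * (1026 * n%:R * I) by rewrite ler_wpM2l.
  have : 0 <= n%:R ^+ 2 * I by rewrite mulr_ge0 ?sqr_ge0.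
  lra.
have pt : `|p.[t]| <= 2 * M.
  have ab : - (1 / 3) < b by lra.
  apply: (extrapolate n0 sp ab pM bt).
  have : 32 * n%:R ^+ 2 * t <= 32 * n%:R ^+ 2 * 1 by rewrite ler_pM2l.
  lra.
have pt2 : p.[t] ^+ 2 <= 4 * M ^+ 2.
  have -> : 4 * M ^+ 2 = (2 * M) ^+ 2 by ring.
  by rewrite -real_normK ?num_real// ler_sqr ?nnegrE// mulr_ge0.
have w0 : 0 <= Num.sqrt (1 - t) by exact: sqrtr_ge0.
have w2 : Num.sqrt (1 - t) ^+ 2 = 1 - t by rewrite sqr_sqrtr//; lra.
move: (Num.sqrt (1 - t) : R) w0 w2 => w w0 w2.
have nw : 5 * (n%:R * w) <= 1.
  by rewrite -ler_sqr ?nnegrE ?mulr_ge0// !exprMn w2; lra.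
apply: le_trans (_ : 4 * M ^+ 2 * w <= _); first by rewrite ler_wpM2r.
rewrite M2.
have : 0 <= n%:R * I by rewrite mulr_ge0.
have : 5 * (n%:R * w) * (n%:R * I) <= 1 * (n%:R * I) by rewrite ler_wpM2r ?mulr_ge0.
lra.
Qed.

Lemma horner_sqr_le_itv (R : realType) (n : nat) (p P : {poly R}) (a b t : R) :
  (0 < n)%N -> (size p <= n.+1)%N -> P^`() = p ^+ 2 -> a < b ->
  a + (b - a) / 3 <= t <= b ->
  p.[t] ^+ 2 * Num.sqrt (2 * (b - t) / (b - a)) <=
    10400 * n%:R / (b - a) * (P.[b] - P.[a]).
Proof.
move=> n0 sp Pp ab /andP[t1 t2].
have ba0 : 0 < b - a by rewrite subr_gt0.
pose r := (b - a) / 2; pose L : {poly R} := r *: 'X + ((a + b) / 2)%:P.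
have r0 : 0 < r by rewrite divr_gt0.
have LE s : L.[s] = r * s + (a + b) / 2 by rewrite !hornerE.
have sq : (size (p \Po L) <= n.+1)%N.
  rewrite size_comp_poly2// size_polyDl size_scale ?size_polyX ?gt_eqF//.
  by rewrite (leq_ltn_trans (size_polyC_leq1 _)).
have dQ : (r^-1 *: (P \Po L))^`() = (p \Po L) ^+ 2.
  rewrite derivZ deriv_comp Pp derivD derivZ derivX derivC addr0 rmorphXn /=.
  by rewrite alg_polyC mulrC mul_polyC scalerA mulVf ?scale1r// gt_eqF.
pose s := (t - (a + b) / 2) / r.
have sE : s * r = t - (a + b) / 2 by rewrite /s divfK// gt_eqF.
have s_itv : - (1 / 3) <= s <= 1.
  by rewrite /s ler_pdivlMr// ler_pdivrMr// /r; apply/andP; split; lra.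
have := horner_sqr_le n0 sq dQ s_itv.
rewrite !hornerZ !horner_comp !LE mulr1 mulrN1 -mulrBr [r * s]mulrC sE subrK.
have -> : r + (a + b) / 2 = b by rewrite /r; field.
have -> : - r + (a + b) / 2 = a by rewrite /r; field.
have -> : 1 - s = 2 * (b - t) / (b - a).
  by rewrite /s /r; field; rewrite gt_eqF.
have -> : 5200 * n%:R * (r^-1 * (P.[b] - P.[a])) = 10400 * n%:R / (b - a) * (P.[b] - P.[a]).
  by rewrite /r; field; rewrite gt_eqF.
by [].
Qed.

(* The polynomials in [y = sin^2 t] equal to [sin ((2 k + 1) t) / sin t] and
   [cos ((2 k + 1) t) / cos t]. *)
Fixpoint odd_multiple (R : realType) (k : nat) : {poly R} * {poly R} :=
  if k is k'.+1 then
    let: (q, c) := odd_multiple R k' in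
    (q * (1 - 2%:P * 'X) + 2%:P * (1 - 'X) * c, c * (1 - 2%:P * 'X) - 2%:P * 'X * q)
  else (1, 1).
Arguments odd_multiple R k : clear implicits.

Lemma size_odd_multiple (R : realType) (k : nat) :
  (size (odd_multiple R k).1 <= k.+1)%N /\ (size (odd_multiple R k).2 <= k.+1)%N.
Proof.
elim: k => [|k [IH1 IH2]] /=; first by rewrite size_poly1.
case: (odd_multiple R k) IH1 IH2 => q c /= sq sc.
have step (a b : {poly R}) : (size a <= 2)%N -> (size b <= k.+1)%N ->
    (size (a * b)%R <= k.+2)%N.
  move=> sa sb; rewrite (leq_trans (size_polyMleq _ _))// -subn1 leq_subLR.
  by rewrite (leq_trans (leq_add sa sb)).
have s2 (a b : R) : (size (a%:P + b%:P * 'X)%R <= 2)%N.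
  rewrite (leq_trans (size_polyD _ _))// geq_max (leq_trans (size_polyC_leq1 _))//=.
  by rewrite mul_polyC (leq_trans (size_scale_leq _ _))// size_polyX.
split; rewrite (leq_trans (size_polyD _ _))// geq_max ?size_polyN; apply/andP; split.
- rewrite mulrC (_ : 1 - _ = 1%:P + (-2)%:P * 'X); first exact: step.
  by rewrite polyCN mulNr.
- rewrite (_ : 2%:P * (1 - 'X) = 2%:P + (-2)%:P * 'X); first exact: step.
  by rewrite polyCN; ring.
- rewrite mulrC (_ : 1 - _ = 1%:P + (-2)%:P * 'X); first exact: step.
  by rewrite polyCN mulNr.
- rewrite (_ : 2%:P * 'X = 0%:P + 2%:P * 'X); first exact: step.
  by rewrite add0r.
Qed.

(** With [y = sin^2 t] the identity is [sin^2 + cos^2 = 1] at the angle [(2k + 1) t]. It bounds the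
    term added to [q] at each step by 2. *)
Lemma odd_multiple_bounds (R : realType) (k : nat) (y : R) : 0 <= y <= 1 ->
  y * (odd_multiple R k).1.[y] ^+ 2 + (1 - y) * (odd_multiple R k).2.[y] ^+ 2 = 1 /\
  `|(odd_multiple R k).1.[y]| <= (2 * k + 1)%:R.
Proof.
move=> /andP[y0 y1]; elim: k => [|k [IH1 IH2]] /=.
  by rewrite !hornerE /= normr1; split=> //; ring.
case: (odd_multiple R k) IH1 IH2 => q c /= IH1 IH2; rewrite !hornerE /=.
split; first by rewrite -[RHS]IH1; ring.
have -> : (2 * k.+1 + 1)%:R = (2 * k + 1)%:R + 2 :> R by rewrite -natrD; congr _%:R; lia.
rewrite (le_trans (ler_normD _ _))// lerD//.
  rewrite normrM (le_trans _ IH2)// ler_piMr// ler_norml; lra.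
rewrite -mulrA normrM (ger0_norm (ler0n _ 2)) ler_piMr//.
have c2 : ((1 - y) * c.[y]) ^+ 2 <= 1.
  have q0 : 0 <= y * q.[y] ^+ 2 by rewrite mulr_ge0 ?sqr_ge0.
  have c0 : 0 <= (1 - y) * c.[y] ^+ 2 by rewrite mulr_ge0 ?sqr_ge0// subr_ge0.
  have : (1 - y) * ((1 - y) * c.[y] ^+ 2) <= 1 * ((1 - y) * c.[y] ^+ 2).
    by rewrite ler_wpM2r//; lra.
  by rewrite exprMn expr2; lra.
by rewrite -(@expr_le1 _ 2)// real_normK ?num_real.
Qed.

Lemma odd_multiple0 (R : realType) (k : nat) :
  (odd_multiple R k).1.[0] = (2 * k + 1)%:R /\ (odd_multiple R k).2.[0] = 1.
Proof.
elim: k => [|k [IH1 IH2]] /=; first by rewrite !hornerE.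
case: (odd_multiple R k) IH1 IH2 => q c /= IH1 IH2; rewrite !hornerE /= IH1 IH2.
by rewrite !natrD !natrM -natr1; split; ring.
Qed.

(** With [t = 2 sin s] this is the Fejer-type kernel [(sin((2k+1) s) / ((2k+1) sin s))^2]. The range
    [[-2, 2]] contains the arguments [u - u0] and [- u - u0] for [u], [u0] in [[0, 1]]. *)
Lemma exists_decreasing_poly (R : realType) (k : nat) :
  exists h : {poly R}, [/\ (size h <= 4 * k + 1)%N, h.[0] = 1 &
    forall t, -2 <= t <= 2 ->
      [/\ 0 <= h.[t], h.[t] <= 1 & t ^+ 2 * h.[t] <= 4 / (2 * k + 1)%:R ^+ 2]].
Proof.
pose N : R := (2 * k + 1)%:R.
have N0 : 0 < N by rewrite ltr0n addn1.
pose q := (odd_multiple R k).1; pose h := (N^-1 *: (q \Po (4^-1 *: 'X^2))) ^+ 2.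
have hE t : h.[t] = (q.[t ^+ 2 / 4] / N) ^+ 2.
  by rewrite /h horner_exp hornerZ horner_comp hornerZ hornerXn mulrC [4^-1 * _]mulrC.
exists h; split.
- rewrite /h expr2 (leq_trans (size_polyMleq _ _))// -subn1 leq_subLR.
  have sq : (size (N^-1 *: (q \Po (4^-1 *: 'X^2))) <= 2 * k + 1)%N.
    rewrite (leq_trans (size_scale_leq _ _))//.
    rewrite (leq_trans (size_comp_poly_leq _ _))//.
    rewrite size_scale ?size_polyXn ?invr_eq0//=.
    by move: (size_odd_multiple R k).1; rewrite -/q; case: (size q) => [|m]; lia.
  by rewrite (leq_trans (leq_add sq sq))//; lia.
- rewrite hE expr0n/= mul0r; have [-> _] := odd_multiple0 R k.
  by rewrite mulfV ?expr1n// gt_eqF.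
move=> t t2; rewrite hE.
have y01 : 0 <= t ^+ 2 / 4 <= 1.
  by rewrite divr_ge0 ?sqr_ge0//= ler_pdivrMr// mul1r; nra.
have [h1 h2] := odd_multiple_bounds k y01; rewrite -/q -/N in h1 h2.
set Q := q.[_] in h1 h2 *; set C := _.[_] in h1; move: y01 => /andP[y0 y1].
split; first exact: sqr_ge0.
  rewrite -real_normK ?num_real// expr_le1// normrM normfV (gtr0_norm N0).
  by rewrite ler_pdivrMr// mul1r.
rewrite exprMn exprVn mulrA ler_pM2r ?invr_gt0 ?exprn_gt0//.
have : 0 <= (1 - t ^+ 2 / 4) * C ^+ 2 by rewrite mulr_ge0 ?sqr_ge0// subr_ge0.
lra.
Qed.

Lemma exists_primitive (R : realType) (q : {poly R}) : exists P : {poly R}, P^`() = q.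
Proof.
exists (\poly_(i < (size q).+1) (q`_i.-1 / i%:R)); apply/polyP => i.
rewrite coef_deriv coef_poly ltnS /=.
case: ltnP => [_|si]; last by rewrite mul0rn nth_default.
by rewrite -[_ *+ i.+1]mulr_natr divfK// pnatr_eq0.
Qed.

(** The function [w^2 / (w + |t - v|)^2] has integral [2 w] over the line. *)
Lemma primitive_peak_le (R : realType) (p P : {poly R}) (v w K : R) :
  0 <= v <= 1 -> 0 < w -> P^`() = p ^+ 2 ->
  (forall t : R, 0 <= t <= 1 -> p.[t] ^+ 2 * (w + `|t - v|) ^+ 2 <= K * w ^+ 2) ->
  P.[1] - P.[0] <= 2 * K * w.
Proof.
move=> /andP[v0 v1] w0 Pp pK.
have K0 : 0 <= K.
  have := pK v; rewrite v0 v1 subrr normr0 addr0 => /(_ isT).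
  by rewrite ler_pM2r ?exprn_gt0//; exact: le_trans (sqr_ge0 _).
(* The sign [s] is 1 to the right of [v] and -1 to the left, where [|t - v| = s (t - v)] and the
   comparison function has an explicit primitive. *)
have D (s : R) (t : R) : 0 < w + s * (t - v) ->
    is_derive t (1 : R) (fun u => - s * K * w ^+ 2 * (w + s * (u - v))^-1 - P.[u])
      (s ^+ 2 * K * w ^+ 2 / (w + s * (t - v)) ^+ 2 - p.[t] ^+ 2).
  move=> wst.
  have H1 : is_derive t (1 : R) (fun u : R => w + s * (u - v)) s.
    by apply: is_derive_eq; rewrite /GRing.scale /=; ring.
  have H2 := @is_deriveV R (fun u => w + s * (u - v)) t s 1 (lt0r_neq0 wst) H1.
  rewrite (_ : (fun u => _) =
    (- s * K * w ^+ 2) *: (fun u => (w + s * (u - v))^-1) - horner P)//.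
  apply: is_derive_eq; rewrite Pp horner_exp /GRing.scale /=.
  by field; exact: lt0r_neq0.
have pos (s t : R) : s ^+ 2 = 1 -> 0 <= t <= 1 -> `|t - v| = s * (t - v) ->
    0 <= s ^+ 2 * K * w ^+ 2 / (w + s * (t - v)) ^+ 2 - p.[t] ^+ 2.
  move=> s1 t01 ts; rewrite subr_ge0 s1 mul1r ler_pdivlMr -?ts; first exact: pK.
  by rewrite exprn_gt0// ltr_wpDr.
pose df (s t : R) := s ^+ 2 * K * w ^+ 2 / (w + s * (t - v)) ^+ 2 - p.[t] ^+ 2.
pose f (s u : R) := - s * K * w ^+ 2 * (w + s * (u - v))^-1 - P.[u].
have right : f 1 v <= f 1 1.
  apply: (@le_of_is_derive_ge0 R (f 1) (df 1) v 1 v1) => t /andP[t1 t2].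
    by apply: (D 1 t); clear -t1 w0; lra.
  by apply: (pos 1 t); rewrite ?expr1n ?mul1r ?ger0_norm//; lra.
have left : f (-1) 0 <= f (-1) v.
  apply: (@le_of_is_derive_ge0 R (f (-1)) (df (-1)) 0 v v0) => t /andP[t1 t2].
    by apply: (D (-1) t); clear -t2 w0; lra.
  by apply: (pos (-1) t); rewrite ?sqrrN ?expr1n ?mulN1r ?ler0_norm//; lra.
have Kw : K * w ^+ 2 * w^-1 = K * w by field; rewrite gt_eqF.
have E1 : 0 <= K * w ^+ 2 * (w + 1 * (1 - v))^-1.
  by apply: mulr_ge0; [rewrite mulr_ge0 ?sqr_ge0|rewrite invr_ge0; clear -w0 v0 v1; lra].
have E2 : 0 <= K * w ^+ 2 * (w + (-1) * (0 - v))^-1.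
  by apply: mulr_ge0; [rewrite mulr_ge0 ?sqr_ge0|rewrite invr_ge0; clear -w0 v0 v1; lra].
move: right left; rewrite /f subrr !mulr0 !addr0 opprK !mulN1r !mul1r !mulNr Kw.
by move: E1 E2; rewrite mul1r mulN1r; lra.
Qed.

(* With [v = u ^ 2], the polynomial [h (u - u0) + h (u + u0)] is even in [u]. *)
Lemma exists_peak_poly (R : realType) (k : nat) (v0 : R) : 0 <= v0 <= 1 ->
  exists p P : {poly R}, [/\ (size p <= 2 * k + 1)%N, P^`() = p ^+ 2, 1 <= p.[v0] &
    P.[1] - P.[0] <= 800 * (Num.sqrt v0 / (2 * k + 1)%:R + (2 * k + 1)%:R ^- 2)].
Proof.
move=> /andP[v00 v01].
have [h [sh h0 hb]] := exists_decreasing_poly R k.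
set N : R := (2 * k + 1)%:R in hb *; have N0 : 0 < N by rewrite ltr0n addn1.
pose u0 := Num.sqrt v0; have u00 : 0 <= u0 by exact: sqrtr_ge0.
have u0v : u0 ^+ 2 = v0 by rewrite sqr_sqrtr.
have u01 : u0 <= 1 by rewrite -(@expr_le1 _ 2)// u0v.
rewrite -/u0; move: u0 u00 u0v u01 => u0 u00 u0v u01.
(* Twice the even part of [f], as a polynomial in [u^2], is [f(u) + f(-u)]; passing to [u^2] also
   halves the degree. *)
pose f := h \Po ('X - u0%:P); pose p := 2%:P * even_poly f.
have fE u : f.[u] = h.[u - u0] by rewrite /f horner_comp !hornerE.
have fe u : f.[u] = (even_poly f).[u ^+ 2] + (odd_poly f).[u ^+ 2] * u.
  by rewrite -{1}(poly_even_odd f) hornerD hornerM hornerX !horner_comp !hornerXn.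
have pE u : p.[u ^+ 2] = h.[u - u0] + h.[- u - u0].
  rewrite -!fE !fe sqrrN /p hornerM hornerC; ring.
have sf : (size f <= 4 * k + 1)%N by rewrite size_comp_poly2// size_XsubC.
have sp : (size p <= 2 * k + 1)%N.
  rewrite /p mul_polyC (leq_trans (size_scale_leq _ _))//.
  by rewrite (leq_trans (size_even_poly _))// uphalfE; lia.
have [P PD] := exists_primitive (p ^+ 2).
(* The width of the peak in the variable [u^2]: a change of [u] by [1 / N] near [u0] moves [u^2] by
   about [u0 / N + 1 / N^2]. *)
pose w := u0 / N + N ^- 2.
have w0 : 0 < w by rewrite ltr_wpDl ?divr_ge0 ?invr_gt0 ?exprn_gt0// ltW.
exists p, P; split=> //.
  rewrite -u0v pE subrr h0 lerDl.
  by have [|] := hb (- u0 - u0) _; first lra.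
rewrite (_ : 800 = 2 * 400); last by rewrite -natrM.
rewrite -/w; apply: (@primitive_peak_le _ p P v0) => //; first by rewrite v00.
move=> t /andP[t0 t1].
pose u := Num.sqrt t; have uu : 0 <= u by exact: sqrtr_ge0.
have ut : u ^+ 2 = t by rewrite sqr_sqrtr.
have u1 : u <= 1 by rewrite -(@expr_le1 _ 2)// ut.
have d1 : -2 <= u - u0 <= 2 by lra.
have d2 : -2 <= - u - u0 <= 2 by lra.
have [a1 a2 a3] := hb _ d1; have [b1 b2 b3] := hb _ d2.
have pt := pE u; rewrite ut in pt.
have p0 : 0 <= p.[t] by rewrite pt addr_ge0.
set d := `|u - u0|; have d0 : 0 <= d by exact: normr_ge0.
have dd : d ^+ 2 = (u - u0) ^+ 2 by rewrite real_normK ?num_real.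
have pd : p.[t] * (N * d) ^+ 2 <= 8.
  (* Since [u] and [u0] are nonnegative, the mirror peak at [- u0] is at least as far away as the
     peak at [u0]. *)
  have h1 : (u - u0) ^+ 2 * h.[- u - u0] <= (- u - u0) ^+ 2 * h.[- u - u0].
    by rewrite ler_wpM2r// -subr_ge0 (_ : _ - _ = 4 * (u * u0)) ?mulr_ge0//; ring.
  have h2 : (u - u0) ^+ 2 * p.[t] <= 8 / N ^+ 2 by rewrite pt mulrDr; lra.
  rewrite exprMn dd mulrCA -[leRHS](divfK (lt0r_neq0 (exprn_gt0 2 N0))).
  by rewrite mulrC ler_pM2r ?exprn_gt0// mulrC.
have sd : `|t - v0| <= d ^+ 2 + 2 * u0 * d.
  rewrite -ut -u0v subr_sqr normrM -/d expr2 -mulrDl mulrC ler_wpM2r//.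
  rewrite ger0_norm; last lra.
  have : u - u0 <= d by exact: ler_norm.
  lra.
(* The decay [1 / (N d)^2] in [u] thus becomes decay in [t] at scale [w]. With [p <= 2] and
   [p (N d)^2 <= 8], the constant is [2 * 2 + 2 * 8 = 20]. *)
have ws : w + `|t - v0| <= w * (1 + N * d) ^+ 2.
  have e1 : w * N ^+ 2 = u0 * N + 1 by rewrite /w; field; rewrite gt_eqF.
  have e2 : w * N = u0 + N^-1 by rewrite /w; field; rewrite gt_eqF.
  have -> : w * (1 + N * d) ^+ 2 = w + 2 * (w * N) * d + (w * N ^+ 2) * d ^+ 2 by ring.
  rewrite e1 e2.
  have : 0 <= N^-1 * d by rewrite mulr_ge0// invr_ge0 ltW.
  have : 0 <= u0 * N * d ^+ 2 by rewrite !mulr_ge0 ?sqr_ge0// ltW.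
  lra.
have pws : p.[t] * (w + `|t - v0|) <= 20 * w.
  apply: le_trans (_ : p.[t] * (w * (1 + N * d) ^+ 2) <= _); first by rewrite ler_wpM2l.
  rewrite mulrCA mulrC ler_pM2r//.
  have : (1 + N * d) ^+ 2 <= 2 * (1 + (N * d) ^+ 2).
    by rewrite -subr_ge0 (_ : _ - _ = (1 - N * d) ^+ 2) ?sqr_ge0//; ring.
  move=> /(ler_wpM2l p0); move=> /le_trans; apply.
  have p2 : p.[t] <= 2 by rewrite pt; lra.
  by rewrite mulrCA mulrDr mulr1; lra.
rewrite -exprMn (_ : 400 * w ^+ 2 = (20 * w) ^+ 2); last by ring.
rewrite ler_sqr// nnegrE mulr_ge0//; last by rewrite ltW.
by rewrite addr_ge0// ltW.
Qed.

(** * Lebesgue measure on the plane *)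

Section LebesgueAffine.
Variable R : realType.
Local Notation leb := (@lebesgue_measure R).
Local Notation leb2 := (leb \x leb)%E.
Local Open Scope ereal_scope.

Lemma measurable_affine1 (a b : R) :
  measurable_fun setT (fun x : measurableTypeR R => (a * x + b)%R : measurableTypeR R).
Proof. by apply: measurable_funD => //; apply: measurable_funM. Qed.

(** The scaled pushforward gives every interval []c, d]] its length, which characterizes Lebesgue
    measure. *)
Lemma lebesgue_measure_affine (a b : R) (A : set (measurableTypeR R)) :
  a != 0%R -> measurable A ->
  `|a|%:E * leb ((fun x => (a * x + b)%R) @^-1` A) = leb A.
Proof.
move=> a0 mA.
pose phi := (fun x : measurableTypeR R => (a * x + b)%R : measurableTypeR R).
have mphi : measurable_fun setT phi := measurable_affine1 a b.
pose m' : {measure set (measurableTypeR R) -> \bar R} :=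
  mscale (NngNum (normr_ge0 a))
    (measure_function_pushforward__canonical__measure_function_Measure leb mphi).
apply/esym; rewrite (_ : _ * _ = m' A)//.
apply: lebesgue_measure_unique => //= _ [[c d]] _ <-.
rewrite (_ : m' _ = `|a|%:E * leb (phi @^-1` `]c, d]%classic))//.
have [a_gt0|a_lt0|a_eq0] := ltgtP 0%R a; last by rewrite -a_eq0 eqxx in a0.
  have -> : phi @^-1` `]c, d]%classic = `]((c - b) / a)%R, ((d - b) / a)%R]%classic.
    apply/seteqP; split => x /=; rewrite !in_itv/= ltr_pdivrMr// ler_pdivlMr//;
      by rewrite [(x * a)%R]mulrC ltrBlDr lerBrDr.
  rewrite !lebesgue_measure_itv/= !lte_fin ltr_pM2r ?invr_gt0// ltrD2r.
  case: ifPn => _; last by rewrite mule0.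
  by rewrite -!EFinB -EFinM (gtr0_norm a_gt0); congr EFin; field.
have -> : phi @^-1` `]c, d]%classic = `[((d - b) / a)%R, ((c - b) / a)%R[%classic.
  apply/seteqP; split => x /=; rewrite !in_itv/= ltr_ndivlMr// ler_ndivrMr//;
    by rewrite [(x * a)%R]mulrC ltrBlDr lerBrDr andbC.
rewrite !lebesgue_measure_itv/= !lte_fin ltr_nM2r ?invr_lt0// ltrD2r.
case: ifPn => _; last by rewrite mule0.
by rewrite -!EFinB -EFinM (ltr0_norm a_lt0); congr EFin; field.
Qed.

Lemma ge0_integral_affine (a b : R) (f : R -> \bar R) : a != 0%R ->
  measurable_fun [set: measurableTypeR R] f -> (forall x, 0 <= f x) ->
  \int[leb]_x f x = `|a|%:E * \int[leb]_x f (a * x + b)%R.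
Proof.
move=> a0 mf f0.
pose phi := (fun x : measurableTypeR R => (a * x + b)%R : measurableTypeR R).
have mphi : measurable_fun setT phi := measurable_affine1 a b.
pose m' : {measure set (measurableTypeR R) -> \bar R} :=
  mscale (NngNum (normr_ge0 a))
    (measure_function_pushforward__canonical__measure_function_Measure leb mphi).
transitivity (\int[m']_x f x).
  apply: eq_measure_integral => A mA _.
  exact: esym (lebesgue_measure_affine b a0 mA).
by rewrite ge0_integral_mscale//= ge0_integral_pushforward.
Qed.

Lemma ge0_integral_swap (f : R * R -> \bar R) :
  measurable_fun [set: measurableTypeR R * measurableTypeR R] f ->
  (forall x, 0 <= f x) ->
  \int[leb2]_p f p = \int[leb2]_p f (p.2, p.1).
Proof.
move=> mf f0.
rewrite (fubini_tonelli1 (m1 := leb) (m2 := leb))// /fubini_F.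
rewrite (fubini_tonelli2 (m1 := leb) (m2 := leb) (fun p => f (p.2, p.1)))//=.
by apply: measurableT_comp => //; exact: measurable_fun_pair.
Qed.

Let affine2 (a b c d z1 z2 : R) (p : R * R) : R * R :=
  ((a * p.1 + b * p.2 + z1)%R, (c * p.1 + d * p.2 + z2)%R).

Let measurable_affine2 (a b c d z1 z2 : R) :
  measurable_fun [set: measurableTypeR R * measurableTypeR R]
    (affine2 a b c d z1 z2 : measurableTypeR R * measurableTypeR R -> _).
Proof.
apply: measurable_fun_pair; apply: measurable_funD => //;
  by apply: measurable_funD; apply: measurable_funM.
Qed.

Let ge0_integral_affine2_nz (a b c d z1 z2 : R) (f : R * R -> \bar R) :
  a != 0%R -> (a * d - b * c)%R != 0%R ->
  measurable_fun [set: measurableTypeR R * measurableTypeR R] f ->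
  (forall x, 0 <= f x) ->
  \int[leb2]_p f p = `|a * d - b * c|%:E * \int[leb2]_p f (affine2 a b c d z1 z2 p).
Proof.
move=> a0 D0 mf f0.
(* The second new coordinate, expressed by the first new coordinate [x'] and the second old one: it
   is affine in the latter with slope [(ad - bc) / a]. *)
pose k (x' : R) : R := (c / a * (x' - z1) + z2)%R.
pose g (p : R * R) := f (p.1, ((a * d - b * c) / a * p.2 + k p.1)%R).
have mg : measurable_fun [set: measurableTypeR R * measurableTypeR R] g.
  apply: measurableT_comp => //; apply: measurable_fun_pair => //.
  apply: measurable_funD; first exact: measurable_funM.
  apply: measurable_funD => //; apply: measurable_funM => //.
  exact: measurable_funD.
have g0 p : 0 <= g p by exact: f0.
have -> : \int[leb2]_p f (affine2 a b c d z1 z2 p) = `|a|^-1%:E * \int[leb2]_p g p.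
  rewrite (fubini_tonelli2 (m1 := leb) (m2 := leb))//; last first.
    exact: (measurableT_comp mf (measurable_affine2 a b c d z1 z2)).
  rewrite (fubini_tonelli2 (m1 := leb) (m2 := leb) g)//.
  rewrite -ge0_integralZl//; last 2 first.
    exact: (measurable_fun_fubini_tonelli_G (m1 := leb) g mg g0).
    by move=> y _; apply: integral_ge0.
  apply: eq_integral => y _; rewrite /fubini_G.
  rewrite (@ge0_integral_affine a (b * y + z1)%R (fun x => g (x, y)))//; last first.
    exact: measurable_fun_pair1.
  rewrite muleA -EFinM mulVf ?normr_eq0// mul1e; apply: eq_integral => x _.
  rewrite /g /affine2 /k/=; congr (f (_, _)); first by rewrite addrA.
  by field.
rewrite muleA -EFinM.
rewrite (fubini_tonelli1 (m1 := leb) (m2 := leb))// (fubini_tonelli1 (m1 := leb) (m2 := leb) g)//.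
rewrite -ge0_integralZl//; last 2 first.
  exact: (measurable_fun_fubini_tonelli_F (m2 := leb) g mg g0).
  by move=> x _; apply: integral_ge0.
apply: eq_integral => x _; rewrite /fubini_F /g/=.
have c0 : ((a * d - b * c) / a)%R != 0%R by rewrite mulf_neq0 ?invr_eq0.
rewrite (@ge0_integral_affine ((a * d - b * c) / a)%R (k x) (fun y => f (x, y)))//.
  by rewrite normrM normfV.
exact: measurable_fun_pair2.
Qed.

(* The linear map is a product of two maps changing one coordinate each;
   Tonelli reduces both to the line. *)
Lemma ge0_integral_affine2 (a b c d z1 z2 : R) (f : R * R -> \bar R) :
  (a * d - b * c)%R != 0%R ->
  measurable_fun [set: measurableTypeR R * measurableTypeR R] f ->
  (forall x, 0 <= f x) ->
  \int[leb2]_p f p = `|a * d - b * c|%:E *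
    \int[leb2]_p f ((a * p.1 + b * p.2 + z1)%R, (c * p.1 + d * p.2 + z2)%R).
Proof.
(* If [a = 0] then [b] is nonzero, and exchanging the variables gives the case already treated. *)
move=> D0 mf f0; have [a0|a0] := eqVneq a 0%R; last exact: ge0_integral_affine2_nz.
have b0 : b != 0%R by apply: contraNneq D0 => ->; rewrite a0 !mul0r subrr.
have D1 : (b * c - a * d)%R != 0%R by rewrite -oppr_eq0 opprB.
rewrite (ge0_integral_affine2_nz z1 z2 b0 D1)// distrC; congr (_ * _).
rewrite [RHS]ge0_integral_swap//.
  by apply: eq_integral => p _; rewrite /affine2/= [(b * _ + _)%R]addrC [(d * _ + _)%R]addrC.
exact: (measurableT_comp mf (measurable_affine2 a b c d z1 z2)).
Qed.

(** For a fixed second coordinate this is a translation of the line. *)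
Lemma ge0_integral_parabola (f : R * R -> \bar R) :
  measurable_fun [set: measurableTypeR R * measurableTypeR R] f ->
  (forall x, 0 <= f x) ->
  \int[leb2]_p f p = \int[leb2]_p f ((p.1 - p.2 ^+ 2)%R, p.2).
Proof.
move=> mf f0; pose g (p : R * R) := f ((p.1 - p.2 ^+ 2)%R, p.2).
have mg : measurable_fun [set: measurableTypeR R * measurableTypeR R] g.
  apply: measurableT_comp => //; apply: measurable_fun_pair => //.
  by apply: measurable_funB => //; exact: measurable_funX.
rewrite (fubini_tonelli2 (m1 := leb) (m2 := leb))//.
rewrite (fubini_tonelli2 (m1 := leb) (m2 := leb) g)//; last by move=> p; exact: f0.
apply: eq_integral => y _; rewrite /fubini_G /g/=.
rewrite (@ge0_integral_affine 1 (- y ^+ 2)%R (fun x => f (x, y)))//.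
  by rewrite normr1 mul1e; apply: eq_integral => x _; rewrite mul1r.
exact: measurable_fun_pair1.
Qed.

End LebesgueAffine.

(** * Vectors, matrices and polynomials in two coordinates *)

Lemma vec2E (R : realType) (p : R * R) :
  (vec2 p 0 0 = p.1) * (vec2 p 1 0 = p.2).
Proof. by rewrite !mxE. Qed.

Lemma cV2P (R : realType) (x y : 'cV[R]_2) : x 0 0 = y 0 0 -> x 1 0 = y 1 0 -> x = y.
Proof.
move=> h0 h1; apply/matrixP => i j; rewrite !ord1.
by case: (unliftP 0 i) => [k ->|->//]; rewrite !ord1 (_ : lift 0 0 = 1)//; apply/val_inj.
Qed.

Lemma sum2 (R : realType) (F : 'I_2 -> R) : \sum_i F i = F 0 + F 1.
Proof.
by rewrite big_ord_recl big_ord1; congr (_ + F _); apply/val_inj.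
Qed.

Lemma det2 (R : realType) (A : 'M[R]_2) : \det A = A 0 0 * A 1 1 - A 0 1 * A 1 0.
Proof.
rewrite (expand_det_row _ 0) sum2 /cofactor !det_mx11 !mxE /=.
have -> : lift 0 0 = 1 :> 'I_2 by apply/val_inj.
have -> : lift 1 0 = 0 :> 'I_2 by apply/val_inj.
by rewrite /= expr0 expr1; ring.
Qed.

Lemma enormE (R : realType) (x : 'cV[R]_2) : enorm x = Num.sqrt (x 0 0 ^+ 2 + x 1 0 ^+ 2).
Proof. by rewrite /enorm sum2. Qed.

Lemma affine_vec2 (R : realType) (z : 'cV[R]_2) (A : 'M[R]_2) (p : R * R) :
  affine z A (vec2 p) =
  vec2 (A 0 0 * p.1 + A 0 1 * p.2 + z 0 0, A 1 0 * p.1 + A 1 1 * p.2 + z 1 0).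
Proof. by apply: cV2P; rewrite vec2E !mxE sum2 !vec2E addrC. Qed.

Lemma prod2 (R : comNzRingType) (F : 'I_2 -> R) : \prod_i F i = F 0 * F 1.
Proof.
by rewrite big_ord_recl big_ord1; congr (_ * F _); apply/val_inj.
Qed.

Lemma mpeval_vec2 (R : realType) (f : mpoly 2 R) (p : R * R) :
  mpeval f (vec2 p) =
  \sum_(m <- msupp f) mcoeff m f * (p.1 ^+ m 0 * p.2 ^+ m 1).
Proof.
by rewrite /mpeval mevalE; apply: eq_bigr => m _; rewrite prod2 !vec2E.
Qed.

(** Used with [e = 1] on lines and [e = 2] on parabolas, where the doubled degree only costs a
    constant. *)
Lemma mpeval_curve (R : realType) (f : mpoly 2 R) (n e : nat) (u v : {poly R}) :
  (mpoly.msize f <= n.+1)%N -> (size u <= e.+1)%N -> (size v <= e.+1)%N ->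
  exists2 p : {poly R}, (size p <= (e * n).+1)%N &
    forall t, p.[t] = mpeval f (vec2 (u.[t], v.[t])).
Proof.
move=> sf su sv.
exists (\sum_(m <- msupp f) mcoeff m f *: (u ^+ m 0 * v ^+ m 1)); last first.
  by move=> t; rewrite horner_sum mpeval_vec2; apply: eq_bigr => m _; rewrite !hornerE.
rewrite big_seq; apply: (big_ind (fun p : {poly R} => (size p <= (e * n).+1)%N)).
- by rewrite size_poly0.
- by move=> p q sp sq; rewrite (leq_trans (size_polyD _ _))// geq_max sp.
move=> m /msize_mdeg_lt mf; rewrite (leq_trans (size_scale_leq _ _))//.
have mn : (m 0%R + m 1%R <= n)%N.
  rewrite -ltnS (leq_trans _ sf)//; move: mf; rewrite mdegE.
  by rewrite big_ord_recl big_ord1 (_ : lift 0 0 = 1)//; apply/val_inj.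
have se (w : {poly R}) k : (size w <= e.+1)%N -> (size (w ^+ k)%R <= (e * k).+1)%N.
  move=> sw; rewrite (leq_trans (size_poly_exp_leq _ _))// ltnS leq_mul2r.
  by rewrite -subn1 leq_subLR add1n sw orbT.
rewrite (leq_trans (size_polyMleq _ _))// -subn1 leq_subLR.
rewrite (leq_trans (leq_add (se _ (m 0) su) (se _ (m 1) sv)))//.
by have := leq_mul (leqnn e) mn; rewrite mulnDr; lia.
Qed.

Section Measurability.
Variable R : realType.
Local Notation mR := (measurableTypeR R).
Local Notation leb := (@lebesgue_measure R).
Local Notation leb2 := (leb \x leb)%E.

Lemma measurable_mpeval (f : mpoly 2 R) :
  measurable_fun [set: mR * mR] (fun p : mR * mR => mpeval f (vec2 p) : mR).
Proof.
under eq_fun do rewrite mpeval_vec2.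
apply: measurable_sum => m; apply: measurable_funM => //.
by apply: measurable_funM; apply: measurable_funX.
Qed.

(** An open set is the countable union of the boxes with rational centre and radius that it
    contains, and a box is a product of intervals. *)
Lemma measurable_plane_open (A : set (R * R)) :
  (forall p, A p -> exists2 e : R, 0 < e &
    forall q : R * R, `|q.1 - p.1| < e -> `|q.2 - p.2| < e -> A q) ->
  measurable (A : set (mR * mR)).
Proof.
move=> Aopen.
pose box (t : rat * rat * rat) : set (mR * mR) :=
  [set x : mR | `|x - ratr t.1.1 : R| < ratr t.2] `*`
  [set x : mR | `|x - ratr t.1.2 : R| < ratr t.2].
have mbox t : measurable (box t).
  apply: measurableX.
    rewrite (_ : [set x | _] = `](ratr t.1.1 - ratr t.2), (ratr t.1.1 + ratr t.2)[%classic)//.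
    by apply/seteqP; split => x /=; rewrite in_itv/= ltr_distl.
  rewrite (_ : [set x | _] = `](ratr t.1.2 - ratr t.2), (ratr t.1.2 + ratr t.2)[%classic)//.
  by apply/seteqP; split => x /=; rewrite in_itv/= ltr_distl.
have -> : A = \bigcup_t (if `[< box t `<=` A >] then box t else set0).
  apply/seteqP; split=> [p Ap|p [t _]]; last by case: asboolP => // h /h.
  have [e e0 he] := Aopen p Ap.
  have [r /andP[r0 re]] : exists r : rat, 0 < (ratr r : R) < e / 2.
    have /rat_in_itvoo[r] : (0 : R) < e / 2 by rewrite divr_gt0.
    by rewrite in_itv/=; exists r.
  have near_rat (x : R) : exists q : rat, `|x - ratr q| < ratr r.
    have /rat_in_itvoo[q] : x - ratr r < x + ratr r by lra.
    rewrite in_itv/= => /andP[q1 q2]; exists q; rewrite ltr_distl.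
    by apply/andP; split; lra.
  have [q1 hq1] := near_rat p.1; have [q2 hq2] := near_rat p.2.
  exists (q1, q2, r) => //; rewrite asboolT//= => q [/= h1 h2]; apply: he.
    by move: hq1 h1; rewrite !ltr_norml; lra.
  by move: hq2 h2; rewrite !ltr_norml; lra.
apply: countable_bigcupT_measurable => [|t]; first exact: countableP.
by case: asboolP.
Qed.

Lemma measurable_vec2_preimage (D : set 'cV[R]_2) :
  closed D -> measurable (vec2 @^-1` D : set (mR * mR)).
Proof.
move=> cD; rewrite -[X in measurable X]setCK; apply: measurableC.
apply: measurable_plane_open => p /= Dp.
have oD : open (~` D) by rewrite openC.
have /nbhs_ballP[e e0 he] : nbhs (vec2 p) (~` D) by apply: open_nbhs_nbhs.
exists e => // q h1 h2; apply: he; split=> // i j; rewrite /ball/= !mxE distrC.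
by case: ifP.
Qed.


Lemma integral_horner_sqr (p P : {poly R}) (a b : R) : a < b -> P^`() = p ^+ 2 ->
  (\int[leb]_(x in `[a, b]) (p.[x] ^+ 2)%:E = (P.[b] - P.[a])%:E)%E.
Proof.
move=> ab Pp; rewrite EFinB.
apply: (@continuous_FTC2 R (fun x => p.[x] ^+ 2) (horner P)) => //.
- apply: continuous_subspaceT => x.
  rewrite (_ : (fun x => _) = horner (p ^+ 2)); first exact: continuous_horner.
  by apply/funext => y; rewrite horner_exp.
- split; first by move=> x _; exact: derivable_horner.
    by apply: cvg_at_right_filter; exact: continuous_horner.
  by apply: cvg_at_left_filter; exact: continuous_horner.
- by move=> x _; rewrite -derivE Pp horner_exp.
Qed.

Lemma mpeval_bounded (f : mpoly 2 R) (K : R) :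
  exists2 M : R, 0 <= M & forall p : R * R, `|p.1| <= K -> `|p.2| <= K ->
    `|mpeval f (vec2 p)| <= M.
Proof.
exists (\sum_(m <- msupp f) `|mcoeff m f| * (`|K| ^+ m 0 * `|K| ^+ m 1)).
  by apply: sumr_ge0 => m _; rewrite !mulr_ge0 ?exprn_ge0.
move=> p p1 p2; rewrite mpeval_vec2 (le_trans (ler_norm_sum _ _ _))//.
have K0 : 0 <= K by exact: le_trans p1.
apply: ler_sum => m _; rewrite !normrM !normrX (ger0_norm K0) ler_wpM2l//.
by rewrite ler_pM ?exprn_ge0// lerXn2r// nnegrE.
Qed.

Lemma enorm_ge (x : 'cV[R]_2) : `|x 0 0| <= enorm x /\ `|x 1 0| <= enorm x.
Proof.
by rewrite enormE -!sqrtr_sqr !ler_sqrt ?addr_ge0 ?sqr_ge0// lerDl lerDr !sqr_ge0.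
Qed.

Lemma dilate2_coord (D : set 'cV[R]_2) (x : 'cV[R]_2) : D `<=` dilate 2 (disk R) -> D x ->
  `|x 0 0| <= 2 /\ `|x 1 0| <= 2.
Proof.
move=> D2 /D2[y y1 <-]; have [h1 h2] := enorm_ge y; rewrite /disk/= in y1.
rewrite !mxE !normrM ger0_norm//; lra.
Qed.

(* Junk value: [integral2] is the finite part of the Lebesgue integral. *)
Lemma integral2_sqrE (D : set 'cV[R]_2) (f : mpoly 2 R) :
  closed D -> D `<=` dilate 2 (disk R) ->
  ((integral2 D (fun y => mpeval f y ^+ 2))%:E =
   \int[leb2]_p ((fun p => (mpeval f (vec2 p) ^+ 2)%:E) \_ (vec2 @^-1` D)) p)%E.
Proof.
move=> cD D2; rewrite -integral_mkcond /integral2 /Rintegral fineK//.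
have mD := measurable_vec2_preimage cD.
rewrite ge0_fin_numE; last by apply: integral_ge0 => p _; rewrite lee_fin sqr_ge0.
have [M M0 hM] := mpeval_bounded f 2.
pose B : set (mR * mR) := `[-2, 2]%classic `*` `[-2, 2]%classic.
have mB : measurable B by apply: measurableX; exact: measurable_itv.
have DB : vec2 @^-1` D `<=` B.
  move=> p /(dilate2_coord D2); rewrite !vec2E => -[h1 h2].
  by split => /=; rewrite in_itv/= -ler_norml.
have mf : measurable_fun setT (fun p : mR * mR => (mpeval f (vec2 p) ^+ 2)%:E).
  by apply/measurable_EFinP; apply: measurable_funX; exact: measurable_mpeval.
apply: le_lt_trans (_ : (\int[leb2]_(p in B) (cst (M ^+ 2)%:E) p < +oo)%E).
  apply: le_trans (_ : (\int[leb2]_(p in vec2 @^-1` D) (cst (M ^+ 2)%:E) p <= _)%E).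
    apply: ge0_le_integral => //.
    - by move=> p _; rewrite lee_fin sqr_ge0.
    - exact: measurable_funTS.
    move=> p /DB[/=]; rewrite !in_itv/= => h1 h2.
    rewrite lee_fin -real_normK ?num_real// lerXn2r ?nnegrE//.
    by apply: hM; rewrite ler_norml.
  by apply: ge0_subset_integral => // p _; rewrite lee_fin sqr_ge0.
rewrite integral_cst//; set I := `[-2, 2]%classic in B mB DB *.
have mI : measurable (I : set mR) by exact: measurable_itv.
rewrite [X in (_ * X < _)%E](product_measure1E leb leb mI mI : _ = (leb I * leb I)%E).
rewrite lebesgue_measure_itv/= !lte_fin.
case: ifP => _; last by rewrite mul0e mule0.
by rewrite -!EFinB -!EFinM ltry.
Qed.

End Measurability.

(** Twice the 5200 of [horner_sqr_le]: rescaling [[a, b]] to [[-1, 1]] contributes [2 / (b - a)]. *)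
Definition christoffel_const (R : realType) : R := 10400.
Arguments christoffel_const R : clear implicits.

Lemma christoffel_const_gt0 (R : realType) : 0 < christoffel_const R.
Proof. by rewrite /christoffel_const ltr0n. Qed.

Lemma horner_sqr_le_integral (R : realType) (n : nat) (p : {poly R}) (a b t : R) :
  (0 < n)%N -> (size p <= n.+1)%N -> a < b -> a + (b - a) / 3 <= t <= b ->
  ((p.[t] ^+ 2 * Num.sqrt (2 * (b - t) / (b - a)))%:E <=
   (christoffel_const R * n%:R / (b - a))%:E *
     \int[@lebesgue_measure R]_(x in `[a, b]) (p.[x] ^+ 2)%:E)%E.
Proof.
move=> n0 sp ab tab; have [P Pp] := exists_primitive (p ^+ 2).
rewrite /christoffel_const; move: (horner_sqr_le_itv n0 sp Pp ab tab).
by rewrite (integral_horner_sqr ab Pp) -EFinM lee_fin.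
Qed.

(** * Lower bounds for the Christoffel function *)

Lemma size_affine_le (R : realType) (a b : R) : (size (a *: 'X + b%:P : {poly R})%R <= 2)%N.
Proof.
rewrite (leq_trans (size_polyD _ _))// geq_max (leq_trans (size_scale_leq _ _)) ?size_polyX//=.
by rewrite (leq_trans (size_polyC_leq1 _)).
Qed.

Lemma size_quadratic_le (R : realType) (a b c : R) :
  (size (a *: 'X^2 + (b *: 'X + c%:P) : {poly R})%R <= 3)%N.
Proof.
rewrite (leq_trans (size_polyD _ _))// geq_max (leq_trans (size_scale_leq _ _)) ?size_polyXn//=.
by rewrite (leq_trans (size_affine_le _ _)).
Qed.

Lemma enorm_sqr (R : realType) (x : 'cV[R]_2) : enorm x ^+ 2 = x 0 0 ^+ 2 + x 1 0 ^+ 2.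
Proof. by rewrite enormE sqr_sqrtr// addr_ge0 ?sqr_ge0. Qed.

Lemma enorm_ge0 (R : realType) (x : 'cV[R]_2) : 0 <= enorm x.
Proof. exact: sqrtr_ge0. Qed.

Lemma diskE (R : realType) (x : 'cV[R]_2) : disk R x <-> x 0 0 ^+ 2 + x 1 0 ^+ 2 <= 1.
Proof. by rewrite /disk/= -enorm_sqr; split; rewrite expr_le1// enorm_ge0. Qed.

(** Lets a point of the disk be assumed to lie at [(r, 0)] with [r >= 0]. *)
Lemma rotation_to (R : realType) (w : 'cV[R]_2) : exists Q : 'M[R]_2,
  [/\ \det Q = 1, Q *m vec2 (enorm w, 0) = w &
      forall x, disk R x -> disk R (Q *m x)].
Proof.
have [c [s [cs wc ws]]] : exists c s : R, [/\ c ^+ 2 + s ^+ 2 = 1, w 0 0 = enorm w * c &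
    w 1 0 = enorm w * s].
  have [w0|w0] := eqVneq (enorm w) 0.
    exists 1, 0; have := enorm_sqr w; rewrite w0 expr0n/= => h.
    have h0 : w 0 0 ^+ 2 = 0 by have := sqr_ge0 (w 0 0); have := sqr_ge0 (w 1 0); lra.
    have h1 : w 1 0 ^+ 2 = 0 by have := sqr_ge0 (w 0 0); have := sqr_ge0 (w 1 0); lra.
    split; first by ring.
      by apply/eqP; rewrite mul0r -sqrf_eq0 h0.
    by apply/eqP; rewrite mul0r -sqrf_eq0 h1.
  exists (w 0 0 / enorm w), (w 1 0 / enorm w); split; [|by rewrite mulrC divfK..].
  by rewrite !expr_div_n -mulrDl -enorm_sqr divff// sqrf_eq0.
pose Q : 'M[R]_2 := \matrix_(i, j)
  (if i == 0 then if j == 0 then c else - s else if j == 0 then s else c).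
have Qx (x : 'cV[R]_2) : ((Q *m x) 0 0 = c * x 0 0 - s * x 1 0) *
    ((Q *m x) 1 0 = s * x 0 0 + c * x 1 0).
  by rewrite !mxE !sum2 !mxE /= mulNr.
exists Q; split.
- by rewrite det2 !mxE /= -[RHS]cs; ring.
- by apply: cV2P; rewrite Qx !vec2E mulr0 ?subr0 ?addr0 mulrC.
- move=> x /diskE x1; apply/diskE; rewrite !Qx.
  by rewrite (_ : _ + _ = (c ^+ 2 + s ^+ 2) * (x 0 0 ^+ 2 + x 1 0 ^+ 2)); [rewrite cs mul1r|ring].
Qed.

Section DiskBound.
Variable R : realType.
Local Notation mR := (measurableTypeR R).
Local Notation leb := (@lebesgue_measure R).
Local Notation leb2 := (leb \x leb)%E.
Local Notation K := (christoffel_const R).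
Let K0 : 0 <= K := ltW (christoffel_const_gt0 R).

(** The critical edge [u = 1] is the parabola [1 - s^2 <= sqrt(1 - s^2)], tangent to the circle from
    inside at [(1, 0)]; this tangency is what lets the coordinates reach the boundary point. *)
Lemma parabola_disk (u s : R) : - (1 / 2) <= u <= 1 -> - (1 / 2) <= s <= 1 / 2 ->
  disk R (vec2 (u - s ^+ 2, s)).
Proof.
move=> /andP[u1 u2] /andP[s1 s2]; apply/diskE; rewrite !vec2E/=.
have s4 : s ^+ 2 <= 1 / 4 by nra.
have s0 := sqr_ge0 s.
have -> : (u - s ^+ 2) ^+ 2 + s ^+ 2 = u ^+ 2 - 2 * u * s ^+ 2 + s ^+ 2 * s ^+ 2 + s ^+ 2 by ring.
move: (s ^+ 2) s4 s0 => t t4 t0.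
have : 0 <= (1 - u) * (u + 1 / 2) by rewrite mulr_ge0; lra.
have : 0 <= t * (u + 1 / 2) by rewrite mulr_ge0; lra.
have : 0 <= t * (1 / 4 - t) by rewrite mulr_ge0; lra.
have : 0 <= (1 - u) * (1 / 4 - t) by rewrite mulr_ge0; lra.
nra.
Qed.

(* In the coordinates [(u, s) |-> (u - s ^ 2, s)], of Jacobian 1, the one
   dimensional bound is applied first along [u], then along [s]. *)
Lemma mpeval_parabola_le (n : nat) (f : mpoly 2 R) (z : 'cV[R]_2) (M : 'M[R]_2) (r : R)
    (F : R * R -> \bar R) :
  (0 < n)%N -> (mpoly.msize f <= n.+1)%N -> 0 <= r <= 1 ->
  measurable_fun [set: mR * mR] F -> (forall p, 0 <= F p)%E ->
  (forall u s, - (1 / 2) <= u <= 1 -> - (1 / 2) <= s <= 1 / 2 ->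
     F (u, s) = (mpeval f (affine z M (vec2 (u - s ^+ 2, s))) ^+ 2)%:E) ->
  ((mpeval f (affine z M (vec2 (r, 0%R))) ^+ 2 * Num.sqrt (1 - r))%:E <=
   ((K * n%:R) * (K * (2 * n)%:R))%:E * \int[leb2]_p F p)%E.
Proof.
move=> n0 sf /andP[r0 r1] mF F0 FE.
pose g (u s : R) := mpeval f (affine z M (vec2 (u - s ^+ 2, s))).
pose q := Num.sqrt (1 - r); have q0 : 0 <= q by exact: sqrtr_ge0.
pose I : set mR := `[- (1 / 2), 1]%classic; pose J : set mR := `[- (1 / 2), 1 / 2]%classic.
have mI : measurable I by exact: measurable_itv.
have mJ : measurable J by exact: measurable_itv.
have [ps sps psE] : exists2 p : {poly R}, (size p <= (2 * n).+1)%N &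
    forall s, p.[s] = g r s.
  have [p sp pE] := mpeval_curve (e := 2) sf
    (size_quadratic_le (- M 0 0) (M 0 1) (M 0 0 * r + z 0 0))
    (size_quadratic_le (- M 1 0) (M 1 1) (M 1 0 * r + z 1 0)).
  exists p => // s; rewrite pE /g affine_vec2 /=; congr (mpeval f (vec2 (_, _))).
    by rewrite !(hornerD, hornerZ, hornerXn, hornerX, hornerC); ring.
  by rewrite !(hornerD, hornerZ, hornerXn, hornerX, hornerC); ring.
(* The point 0 is the midpoint of the interval, so the weight is 1. *)
have step_s : ((g r 0 ^+ 2)%:E <= (K * (2 * n)%:R)%:E * \int[leb]_(s in J) (g r s ^+ 2)%:E)%E.
  have n2 : (0 < 2 * n)%N by rewrite muln_gt0 n0.
  have ab : - (1 / 2) < 1 / 2 :> R by lra.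
  have t0 : - (1 / 2) + (1 / 2 - - (1 / 2)) / 3 <= (0 : R) <= 1 / 2.
    by apply/andP; split; lra.
  have := horner_sqr_le_integral n2 sps ab t0.
  have E1 : 2 * (1 / 2 - 0) / (1 / 2 - - (1 / 2)) = 1 :> R by field.
  have E2 : 1 / 2 - - (1 / 2) = 1 :> R by field.
  rewrite E1 E2 divr1 sqrtr1 mulr1 psE => /le_trans; apply.
  rewrite lee_wpmul2l ?lee_fin ?mulr_ge0//; rewrite le_eqVlt; apply/orP; left; apply/eqP.
  by apply: eq_integral => s _; rewrite psE.
have mg : measurable_fun setT (fun s : mR => (g r s ^+ 2)%:E).
  apply/measurable_EFinP; apply: measurable_funX.
  rewrite (_ : g r = horner ps); last by apply/funext => s; rewrite psE.
  by apply: continuous_measurable_fun; exact: continuous_horner.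
have step_u s : J s -> ((g r s ^+ 2 * q)%:E <= (K * n%:R)%:E * fubini_G leb F s)%E.
  rewrite /J/= in_itv/= => sJ.
  have [pu spu puE] : exists2 p : {poly R}, (size p <= n.+1)%N & forall u, p.[u] = g u s.
    have [p] := mpeval_curve (e := 1) sf
      (size_affine_le (M 0 0) (M 0 1 * s - M 0 0 * s ^+ 2 + z 0 0))
      (size_affine_le (M 1 0) (M 1 1 * s - M 1 0 * s ^+ 2 + z 1 0)).
    rewrite mul1n => sp pE.
    exists p => // u; rewrite pE /g affine_vec2 /=; congr (mpeval f (vec2 (_, _))).
      by rewrite !(hornerD, hornerZ, hornerX, hornerC); ring.
    by rewrite !(hornerD, hornerZ, hornerX, hornerC); ring.
  have ab : - (1 / 2) < 1 :> R by lra.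
  (* The interval [[-1/2, 1]] is such that its right two thirds, where the one dimensional bound
     holds, are exactly [[0, 1]]. *)
  have tr : - (1 / 2) + (1 - - (1 / 2)) / 3 <= r <= 1 by apply/andP; split; lra.
  have := horner_sqr_le_integral n0 spu ab tr.
  have E3 : 1 - - (1 / 2) = 3 / 2 :> R by field.
  rewrite puE E3 => h; apply: le_trans (le_trans _ h) _.
    rewrite lee_fin ler_wpM2l ?sqr_ge0// ler_sqrt; first by lra.
    by rewrite divr_ge0 ?mulr_ge0//; lra.
  have -> : (\int[leb]_(x in I) (pu.[x] ^+ 2)%:E = \int[leb]_(x in I) F (x, s))%E.
    by apply: eq_integral => u; rewrite inE /I/= in_itv/= => uI; rewrite puE FE.
  apply: lee_pmul.
  - by rewrite lee_fin divr_ge0 ?mulr_ge0//; lra.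
  - by apply: integral_ge0 => u _; exact: F0.
  - by rewrite lee_fin ler_piMr ?mulr_ge0// invf_le1; lra.
  - by apply: ge0_subset_integral => //; exact: measurable_fun_pair1.
have gr0 : mpeval f (affine z M (vec2 (r, 0%R))) = g r 0 by rewrite /g expr0n subr0.
rewrite gr0 -/q mulrC EFinM.
apply: le_trans (lee_wpmul2l _ step_s) _; first by rewrite lee_fin.
rewrite muleCA [(K * n%:R) * _]mulrC [in leRHS]EFinM -[leRHS]muleA.
rewrite lee_wpmul2l ?lee_fin ?mulr_ge0//.
rewrite -ge0_integralZl//; last 2 first.
- exact: measurable_funTS.
- by move=> s _; rewrite lee_fin sqr_ge0.
rewrite (fubini_tonelli2 (m1 := leb) (m2 := leb) F)//.
have mG := measurable_fun_fubini_tonelli_G (m1 := leb) F mF F0.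
have G0 s : (0 <= fubini_G leb F s)%E by apply: integral_ge0 => u _; exact: F0.
rewrite -ge0_integralZl//; last by rewrite lee_fin mulr_ge0.
apply: le_trans (_ : (\int[leb]_(s in J) ((K * n%:R)%:E * fubini_G leb F s) <= _)%E).
  apply: ge0_le_integral => //.
  - by move=> s _; rewrite -EFinM lee_fin mulr_ge0 ?sqr_ge0.
  - by apply: emeasurable_funM => //; exact: measurable_funTS.
  - by apply: measurable_funTS; apply: emeasurable_funM.
  - by move=> s Js; rewrite -EFinM mulrC step_u.
apply: ge0_subset_integral; [exact: mJ|exact: measurableT| | |exact: subsetT].
- by apply: emeasurable_funM.
- by move=> s _; rewrite mule_ge0// lee_fin mulr_ge0.
- by move=> s _; exact: G0.
Qed.

Lemma mpeval_disk_le (n : nat) (f : mpoly 2 R) (D : set 'cV[R]_2) (z : 'cV[R]_2)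
    (A : 'M[R]_2) (w : 'cV[R]_2) :
  (0 < n)%N -> (mpoly.msize f <= n.+1)%N -> closed D -> D `<=` dilate 2 (disk R) ->
  A \in unitmx -> affine z A @` disk R `<=` D -> enorm w <= 1 ->
  mpeval f (affine z A w) ^+ 2 * (Num.sqrt (1 - enorm w) * `|\det A|) <=
  (K * n%:R) * (K * (2 * n)%:R) * integral2 D (fun y => mpeval f y ^+ 2).
Proof.
move=> n0 sf cD D2 uA AD w1.
have [Q [detQ Qw Qdisk]] := rotation_to w.
pose M := A *m Q.
have detM : \det M = \det A by rewrite det_mulmx detQ mulr1.
have affM x : affine z M x = affine z A (Q *m x) by rewrite /affine /M mulmxA.
pose F : R * R -> \bar R := (fun p => (mpeval f (vec2 p) ^+ 2)%:E) \_ (vec2 @^-1` D).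
have mF : measurable_fun [set: mR * mR] F.
  apply/(measurable_restrictT _ (measurable_vec2_preimage cD)).
  apply: measurable_funTS; apply/measurable_EFinP; apply: measurable_funX.
  exact: measurable_mpeval.
have F0 p : (0 <= F p)%E.
  by rewrite /F patchE; case: ifP => // _; rewrite lee_fin sqr_ge0.
pose G (p : R * R) :=
  F ((M 0 0 * p.1 + M 0 1 * p.2 + z 0 0)%R, (M 1 0 * p.1 + M 1 1 * p.2 + z 1 0)%R).
have mG : measurable_fun [set: mR * mR] G.
  apply: measurableT_comp => //; apply: measurable_fun_pair;
    by apply: measurable_funD => //; apply: measurable_funD; apply: measurable_funM.
pose H (p : R * R) := G ((p.1 - p.2 ^+ 2)%R, p.2).
have mH : measurable_fun [set: mR * mR] H.
  apply: measurableT_comp => //; apply: measurable_fun_pair => //.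
  by apply: measurable_funB => //; exact: measurable_funX.
have detM0 : M 0 0 * M 1 1 - M 0 1 * M 1 0 != 0.
  by rewrite -det2 detM -unitfE -unitmxE.
have FE : (\int[leb2]_p F p = `|\det A|%:E * \int[leb2]_p H p)%E.
  rewrite (ge0_integral_affine2 (z 0 0) (z 1 0) detM0)// -det2 detM; congr (_ * _)%E.
  by rewrite (ge0_integral_parabola mG)// => p; exact: F0.
have HE u s : - (1 / 2) <= u <= 1 -> - (1 / 2) <= s <= 1 / 2 ->
    H (u, s) = (mpeval f (affine z M (vec2 (u - s ^+ 2, s))) ^+ 2)%:E.
  move=> hu hs; have E := affine_vec2 z M (u - s ^+ 2, s); rewrite /= in E.
  rewrite /H /G /F patchE /= -E mem_set// /preimage/= -E affM.
  by apply: AD; exists (Q *m vec2 (u - s ^+ 2, s)) => //; exact/Qdisk/parabola_disk.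
have r01 : 0 <= enorm w <= 1 by rewrite enorm_ge0.
have := mpeval_parabola_le n0 sf r01 mH (fun p => F0 _) HE.
rewrite affM Qw => h.
rewrite -lee_fin [in X in (_ <= X)%E]EFinM integral2_sqrE// -/F FE muleCA.
rewrite [X in (X%:E <= _)%E](_ : _ = `|\det A| *
  (mpeval f (affine z A w) ^+ 2 * Num.sqrt (1 - enorm w))); last by ring.
by rewrite EFinM lee_wpmul2l.
Qed.

End DiskBound.

Section ConvexBody.
Variables (R : realType) (D : set 'cV[R]_2).
Hypotheses (convD : convex_set D) (compactD : compact D).
Hypotheses (diskD : disk R `<=` D) (Ddisk : D `<=` dilate 2 (disk R)).
Local Notation K := (christoffel_const R).

Let closedD : closed D.
Proof. exact: compact_closed (@norm_hausdorff _ _) compactD. Qed.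

Let D0 : D 0.
Proof. by apply: diskD; apply/diskE; rewrite !mxE expr0n/= addr0. Qed.

Lemma convex_mem (x y : 'cV[R]_2) (t : R) : D x -> D y -> 0 <= t <= 1 ->
  D (t *: x + (1 - t) *: y).
Proof.
move=> Dx Dy /andP[t0 t1].
have := convD (Itv01 t0 t1) (mem_set Dx) (mem_set Dy).
by rewrite inE.
Qed.

Lemma dilate_mem (y : 'cV[R]_2) (t : R) : D y -> 0 <= t <= 1 -> D (t *: y).
Proof. by move=> Dy t01; have := convex_mem Dy D0 t01; rewrite scaler0 addr0. Qed.

Lemma affineZ (s : R) (z : 'cV[R]_2) (A : 'M[R]_2) (w : 'cV[R]_2) :
  affine (s *: z) (s *: A) w = s *: affine z A w.
Proof. by rewrite /affine scalerDr scalemxAl. Qed.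

(* The ellipses [s E], [1/4 <= s <= 1], bound the polynomial on the segment
   [[x / 4, x]]; Chebyshev's inequality extends the bound to [x / t]. *)
Lemma mpeval_ray_le (n : nat) (f : mpoly 2 R) (z : 'cV[R]_2) (A : 'M[R]_2)
    (w x y : 'cV[R]_2) (t : R) :
  (0 < n)%N -> (mpoly.msize f <= n.+1)%N -> A \in unitmx ->
  affine z A @` disk R `<=` D -> enorm w <= 1 -> x = affine z A w ->
  x = t *: y -> 1 - 2 ^- 4 * n%:R ^- 2 <= t <= 1 ->
  mpeval f y ^+ 2 * (Num.sqrt (1 - enorm w) * `|\det A|) <=
  64 * ((K * n%:R) * (K * (2 * n)%:R) * integral2 D (fun y => mpeval f y ^+ 2)).
Proof.
move=> n0 sf uA AD w1 xw xty /andP[t1 t2].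
set J := _ * integral2 _ _; set v := Num.sqrt _ * _.
have v0 : 0 <= v by rewrite mulr_ge0// sqrtr_ge0.
have main s : 1 / 4 <= s <= 1 -> mpeval f (s *: x) ^+ 2 * v <= 16 * J.
  move=> /andP[s1 s2]; have s0 : 0 < s by lra.
  have us : s *: A \in unitmx.
    by rewrite unitmxE detZ unitrM -unitmxE uA andbT unitfE expf_neq0// gt_eqF.
  have sAD : affine (s *: z) (s *: A) @` disk R `<=` D.
    move=> _ [q q1 <-]; rewrite affineZ; apply: dilate_mem; last by rewrite ltW.
    by apply: AD; exists q.
  (* The point [s x] has the same preimage [w] in the scaled ellipse; the determinant is multiplied
     by [s^2 >= 1/16], hence the factor 16. *)
  have := mpeval_disk_le n0 sf closedD Ddisk us sAD w1.
  rewrite affineZ -xw detZ normrM ger0_norm ?sqr_ge0// -/J => h.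
  have s2' : 1 / 16 <= s ^+ 2 by nra.
  have m0 : 0 <= mpeval f (s *: x) ^+ 2 * v by rewrite mulr_ge0 ?sqr_ge0.
  have h' : mpeval f (s *: x) ^+ 2 * v * s ^+ 2 <= J.
    by apply: le_trans h; rewrite /v le_eqVlt; apply/orP; left; apply/eqP; ring.
  have := ler_wpM2l m0 s2'; lra.
have J0 : 0 <= J.
  have h1 : 1 / 4 <= (1 : R) <= 1 by rewrite lexx andbT; lra.
  have h2 : 0 <= mpeval f (1 *: x) ^+ 2 * v by rewrite mulr_ge0 ?sqr_ge0.
  by have := le_trans h2 (main 1 h1); rewrite pmulr_rge0.
have [v00|vn0] := eqVneq v 0; first by rewrite v00 mulr0 mulr_ge0.
have vpos : 0 < v by rewrite lt_neqAle eq_sym vn0.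
have [p] := mpeval_curve (e := 1) sf (size_affine_le (x 0 0) 0) (size_affine_le (x 1 0) 0).
rewrite mul1n => sp pE.
have pE' s : p.[s] = mpeval f (s *: x).
  rewrite pE; congr (mpeval f _); apply: cV2P; rewrite vec2E !mxE.
    by rewrite /= hornerD hornerZ hornerX hornerC addr0 mulrC.
  by rewrite /= hornerD hornerZ hornerX hornerC addr0 mulrC.
pose M := Num.sqrt (16 * J / v).
have M2 : M ^+ 2 = 16 * J / v by rewrite sqr_sqrtr// divr_ge0// mulr_ge0.
have M0 : 0 <= M by exact: sqrtr_ge0.
have pM s : 1 / 4 <= s <= 1 -> `|p.[s]| <= M.
  move=> s1; rewrite -ler_sqr ?nnegrE// real_normK ?num_real// M2 pE'.
  by rewrite ler_pdivlMr// main.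
have nR : 1 <= n%:R :> R by rewrite ler1n.
have n2 : 1 <= n%:R ^+ 2 :> R by rewrite expr_ge1.
have dn : 16 * (1 - t) * n%:R ^+ 2 <= 1.
  have : (1 - t) <= 2 ^- 4 * n%:R ^- 2 by lra.
  rewrite -(ler_pM2r (_ : 0 < 16 * n%:R ^+ 2)); last by rewrite mulr_gt0// (lt_le_trans ltr01).
  have -> : 2 ^- 4 * n%:R ^- 2 * (16 * n%:R ^+ 2) = 1 :> R.
    by field; rewrite gt_eqF// (lt_le_trans ltr01).
  lra.
have t0 : 15 / 16 <= t by nra.
have py : p.[t^-1] = mpeval f y.
  by rewrite pE' xty scalerA mulVf ?scale1r// gt_eqF//; lra.
have tV : 1 <= t^-1 by rewrite invf_ge1//; lra.
(* The left side is at most [8 * (1/16) * (16/15)], so the point [1 / t] is within the reach of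
   [extrapolate] from [[1/4, 1]]. Doubling [|p|] multiplies 16 by 4 and gives 64. *)
have close : 8 * (t^-1 - 1) * n%:R ^+ 2 <= 1 - 1 / 4.
  have -> : t^-1 - 1 = (1 - t) / t by field; rewrite gt_eqF//; lra.
  rewrite [leLHS](_ : _ = 8 * (1 - t) * n%:R ^+ 2 / t); last by ring.
  by rewrite ler_pdivrMr; lra.
have := extrapolate n0 sp (_ : 1 / 4 < 1) pM tV close.
rewrite py => /(_ _) h.
have {}h : `|mpeval f y| <= 2 * M by apply: h; lra.
have h2 : mpeval f y ^+ 2 <= 4 * M ^+ 2.
  have -> : 4 * M ^+ 2 = (2 * M) ^+ 2 by ring.
  by rewrite -real_normK ?num_real// ler_sqr ?nnegrE// mulr_ge0.
apply: le_trans (ler_wpM2r v0 h2) _.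
rewrite M2 [leLHS](_ : _ = 4 * (16 * J * (v / v))); last by ring.
by rewrite divff// mulr1 le_eqVlt; apply/orP; left; apply/eqP; ring.
Qed.

End ConvexBody.

(** * Upper bounds for the Christoffel function *)

(** Here [v] and [v'] are the heights in a strip of the original point and of its image under [tau].
    Depth of the latter gives [1 <= 7 n sqrt(v')], which absorbs the [N^-2] term. *)
Lemma exists_peak_poly_degree (R : realType) (n : nat) (v v' : R) :
  (0 < n)%N -> 0 <= v <= 1 -> v <= 16 / 15 * v' -> 1 <= 48 * n%:R ^+ 2 * v' ->
  exists p P : {poly R}, [/\ (size p <= 2 * (n %/ 4) + 1)%N, P^`() = p ^+ 2, 1 <= p.[v] &
    P.[1] - P.[0] <= 800 * 117 * n%:R^-1 * Num.sqrt v'].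
Proof.
move=> n0 v01 vv' nv'; have [p [P [sp Pp pv PP]]] := exists_peak_poly (n %/ 4) v01.
exists p, P; split=> //; apply: le_trans PP _.
set N := (_ + 1)%N.
have nN : n%:R <= 4 * N%:R :> R by rewrite -natrM ler_nat /N; lia.
have nR : 0 < n%:R :> R by rewrite ltr0n.
have NR : 0 < N%:R :> R by rewrite ltr0n /N addn1.
have n2 : 0 < n%:R ^+ 2 :> R by rewrite exprn_gt0.
have v'0 : 0 <= v' by rewrite -(pmulr_rge0 _ n2); lra.
pose s := Num.sqrt v'; pose r := Num.sqrt v.
have s0 : 0 <= s by exact: sqrtr_ge0.
have r0 : 0 <= r by exact: sqrtr_ge0.
have s2 : s ^+ 2 = v' by rewrite sqr_sqrtr.
have r2 : r ^+ 2 = v by rewrite sqr_sqrtr//; case/andP: v01.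
rewrite -/s -/r -!mulrA; apply: ler_wpM2l; first exact: ler0n.
have rs : r <= 5 / 4 * s.
  by rewrite -ler_sqr ?nnegrE ?mulr_ge0// exprMn r2 s2; lra.
have ns : 1 <= 7 * (n%:R * s).
  by rewrite -ler_sqr ?nnegrE ?mulr_ge0// ?ltW// !exprMn s2; lra.
have NV : N%:R^-1 <= 4 * n%:R^-1 :> R.
  by rewrite -(ler_pM2r NR) mulVf ?gt_eqF// mulrAC ler_pdivlMr// mul1r.
have NV0 : 0 <= N%:R^-1 :> R by rewrite invr_ge0 ltW.
have nV0 : 0 <= n%:R^-1 :> R by rewrite invr_ge0 ltW.
have nV : n%:R^-1 <= 7 * s.
  by rewrite -(ler_pM2r nR) mulVf ?gt_eqF//; lra.
(* [117 = 5 + 112]: the first term contributes [(5/4) * 4], the second [4 * 4 * 7]. *)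
have e1 : r * N%:R^-1 <= (5 / 4 * s) * (4 * n%:R^-1) by rewrite ler_pM.
have e2 : N%:R ^- 2 <= (4 * n%:R^-1) * (4 * n%:R^-1) :> R.
  by rewrite -exprVn expr2 ler_pM.
have e3 : n%:R^-1 * n%:R^-1 <= n%:R^-1 * (7 * s) by rewrite ler_wpM2l.
lra.
Qed.

Lemma msizeM_pred_le (R : realType) (p q : mpoly 2 R) :
  (mpoly.msize (p * q) <= (mpoly.msize p + mpoly.msize q).-1)%N.
Proof.
have [->|p0] := eqVneq p 0; first by rewrite mul0r msize0.
have [->|q0] := eqVneq q 0; first by rewrite mulr0 msize0.
by rewrite msizeM.
Qed.

Lemma mpoly_linear_comp (R : realType) (m : nat) (p : {poly R}) (a b c : R) :
  (size p <= m.+1)%N -> exists2 g : mpoly 2 R, (mpoly.msize g <= m.+1)%N &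
    forall y, mpeval g y = p.[a * y 0 0 + b * y 1 0 + c].
Proof.
pose L : mpoly 2 R := a *: mpolyX R (mnm1 0) + b *: mpolyX R (mnm1 1) + mpolyC 2 c.
have LE y : mpeval L y = a * y 0 0 + b * y 1 0 + c.
  by rewrite /mpeval /L !mevalD !mevalZ !mevalXU mevalC.
have sC (d : R) : (mpoly.msize (mpolyC 2 d) <= 1)%N by rewrite msizeC; case: (_ != 0).
have sL : (mpoly.msize L <= 2)%N.
  rewrite /L (leq_trans (msizeD_le _ _))// geq_max; apply/andP; split; last first.
    by rewrite (leq_trans (sC _)).
  rewrite (leq_trans (msizeD_le _ _))// geq_max.
  by rewrite !(leq_trans (msizeZ_le _ _))// msizeX mdeg1.
elim: m p => [|m IH] p sp.
  exists (mpolyC 2 p`_0) => // y.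
  by rewrite /mpeval mevalC [in RHS](size1_polyC sp) hornerC.
elim/poly_ind: p sp => [|p d _] sp.
  exists 0; first by rewrite msize0.
  by move=> y; rewrite /mpeval meval0 horner0.
have /IH[g sg gE] : (size p <= m.+1)%N.
  have [->|p0] := eqVneq p 0; first by rewrite size_poly0.
  by move: sp; rewrite -cons_poly_def size_cons_poly nil_poly (negPf p0) /=.
exists (g * L + mpolyC 2 d).
  rewrite (leq_trans (msizeD_le _ _))// geq_max (leq_trans (sC _))// andbT.
  by rewrite (leq_trans (msizeM_pred_le _ _))//; lia.
move=> y; have := LE y; have := gE y; rewrite /mpeval => h1 h2.
by rewrite mevalD mevalM mevalC h1 h2 !hornerE.
Qed.

Section UpperBound.
Variables (R : realType) (D : set 'cV[R]_2).
Hypotheses (convD : convex_set D) (compactD : compact D).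
Hypotheses (diskD : disk R `<=` D) (Ddisk : D `<=` dilate 2 (disk R)).
Local Notation mR := (measurableTypeR R).
Local Notation leb := (@lebesgue_measure R).
Local Notation leb2 := (leb \x leb)%E.

Let closedD : closed D.
Proof. exact: compact_closed (@norm_hausdorff _ _) compactD. Qed.

(** In the coordinates [w] the body lies in the unit square. Enlarging the domain to the whole
    square makes the integral a product. *)
Lemma integral2_product_le (z : 'cV[R]_2) (A : 'M[R]_2) (f : mpoly 2 R)
    (p q P Q : {poly R}) :
  A \in unitmx -> P^`() = p ^+ 2 -> Q^`() = q ^+ 2 ->
  (forall w, D (affine z A w) -> [/\ 0 <= w 0 0 <= 1, 0 <= w 1 0 <= 1 &
     mpeval f (affine z A w) = p.[w 0 0] * q.[w 1 0]]) ->
  integral2 D (fun y => mpeval f y ^+ 2) <=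
    `|\det A| * ((P.[1] - P.[0]) * (Q.[1] - Q.[0])).
Proof.
move=> uA Pp Qq fE.
pose F : R * R -> \bar R := (fun p => (mpeval f (vec2 p) ^+ 2)%:E) \_ (vec2 @^-1` D).
have mF : measurable_fun [set: mR * mR] F.
  apply/(measurable_restrictT _ (measurable_vec2_preimage closedD)).
  apply: measurable_funTS; apply/measurable_EFinP; apply: measurable_funX.
  exact: measurable_mpeval.
have F0 x : (0 <= F x)%E.
  by rewrite /F patchE; case: ifP => // _; rewrite lee_fin sqr_ge0.
have detA0 : A 0 0 * A 1 1 - A 0 1 * A 1 0 != 0.
  by rewrite -det2 -unitfE -unitmxE.
pose I : set mR := `[0, 1]%classic.
have mI : measurable I by exact: measurable_itv.
pose h (r : {poly R}) : R -> \bar R := (fun x => (r.[x] ^+ 2)%:E) \_ I.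
have h0 r x : (0 <= h r x)%E.
  by rewrite /h patchE; case: ifP => // _; rewrite lee_fin sqr_ge0.
have mh r : measurable_fun setT (h r : mR -> _).
  apply/(measurable_restrictT _ mI); apply: measurable_funTS.
  apply/measurable_EFinP; apply: measurable_funX.
  by apply: continuous_measurable_fun; exact: continuous_horner.
have hI (r S : {poly R}) : S^`() = r ^+ 2 -> (\int[leb]_x h r x = (S.[1] - S.[0])%:E)%E.
  by move=> Sr; rewrite -integral_mkcond (integral_horner_sqr _ Sr).
pose H (x : R * R) := (h p x.1 * h q x.2)%E.
have H0 x : (0 <= H x)%E by exact: mule_ge0.
have mH : measurable_fun [set: mR * mR] H.
  apply: emeasurable_funM; first exact: (measurableT_comp (mh p) measurable_fst).
  exact: (measurableT_comp (mh q) measurable_snd).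
have HI : (\int[leb2]_x H x = ((P.[1] - P.[0]) * (Q.[1] - Q.[0]))%:E)%E.
  rewrite (fubini_tonelli1 (m1 := leb) (m2 := leb) H)//.
  rewrite EFinM -(hI p P)// -(hI q Q)// -ge0_integralZr//; last first.
    by apply: integral_ge0.
  apply: eq_integral => x _; rewrite /fubini_F /H/=.
  by rewrite ge0_integralZl.
rewrite -lee_fin integral2_sqrE// -/F.
rewrite (ge0_integral_affine2 (z 0 0) (z 1 0) detA0)// -det2 [in leRHS]EFinM -HI.
rewrite lee_wpmul2l// ?lee_fin//; apply: ge0_le_integral => //.
  apply: measurableT_comp => //; apply: measurable_fun_pair;
    by apply: measurable_funD => //; apply: measurable_funD; apply: measurable_funM.
move=> x _; have E := affine_vec2 z A x; rewrite /F patchE.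
case: ifPn => [|_]; last exact: H0.
rewrite inE /preimage/= -E => /fE; rewrite !vec2E => -[w1 w2 ->].
by rewrite /H /h !patchE !mem_set /I/= ?in_itv// -EFinM exprMn.
Qed.

End UpperBound.

(** The dual form of membership in [(1 - e) D], through all half planes containing [D]: this is how
    strips and supporting lines use it. *)
Definition deep (R : realType) (e : R) (D : set 'cV[R]_2) (x : 'cV[R]_2) : Prop :=
  forall a b c : R, (forall y, D y -> a * y 0 0 + b * y 1 0 <= c) ->
    a * x 0 0 + b * x 1 0 <= (1 - e) * c.

Section Strips.
Variables (R : realType) (D : set 'cV[R]_2).
Hypotheses (compactD : compact D).
Hypotheses (diskD : disk R `<=` D) (Ddisk : D `<=` dilate 2 (disk R)).

Let basis_mem (a b : R) : a ^+ 2 + b ^+ 2 <= 1 -> D (vec2 (a, b)).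
Proof. by move=> ab; apply: diskD; apply/diskE; rewrite !vec2E. Qed.

(* The strip containing [D] is first shrunk to a comparable width [s]. *)
Lemma strip_peak (n : nat) (a b c t : R) (x y : 'cV[R]_2) :
  (0 < n)%N -> (a != 0) || (b != 0) ->
  (forall y, D y -> 0 <= a * y 0 0 + b * y 1 0 + c <= 1) ->
  x = t *: y -> 1 - 2 ^- 4 * n%:R ^- 2 <= t <= 1 -> D y ->
  deep (2 ^- 4 * n%:R ^- 2) D x ->
  exists (s : R) (g : mpoly 2 R) (p P : {poly R}),
  [/\ 0 < s, (forall y, D y -> 0 <= a * y 0 0 + b * y 1 0 + c <= s),
     ((mpoly.msize g <= 2 * (n %/ 4) + 1)%N /\ P^`() = p ^+ 2),
     (1 <= mpeval g y /\ forall y, mpeval g y = p.[(a * y 0 0 + b * y 1 0 + c) / s]) &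
     (0 <= a * x 0 0 + b * x 1 0 + c /\ 0 <= P.[1] - P.[0] /\
      s * (P.[1] - P.[0]) <= 800 * 117 * n%:R^-1 * Num.sqrt (a * x 0 0 + b * x 1 0 + c))].
Proof.
move=> n0 ab0 lD xty /andP[t1 t2] Dy deepx.
have nR : 1 <= n%:R :> R by rewrite ler1n.
have n2 : 1 <= n%:R ^+ 2 :> R by rewrite expr_ge1.
have n2' : 0 < n%:R ^+ 2 :> R by exact: lt_le_trans n2.
pose d : R := 2 ^- 4 * n%:R ^- 2; rewrite -/d in t1 deepx.
have dn : 16 * n%:R ^+ 2 * d = 1.
  by rewrite /d; field; rewrite gt_eqF// (lt_le_trans ltr01).
have d0 : 0 <= d by rewrite mulr_ge0 ?invr_ge0 ?exprn_ge0.
have d1 : d <= 1 / 16.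
  have n16 : 0 < 16 * n%:R ^+ 2 :> R by rewrite mulr_gt0.
  by rewrite -(ler_pM2l n16) dn; lra.
pose l (w : 'cV[R]_2) := a * w 0 0 + b * w 1 0 + c.
(* Half of [- w] lies in the disk, so [l] is nonnegative there. Thus [c], the value of [l] at the
   origin, is at least a third of its maximum. *)
have c3 w : D w -> l w <= 3 * c.
  move=> Dw; have [w' w1 w2] := Ddisk Dw.
  have /lD : D (- w').
    by apply: diskD; apply/diskE; rewrite !mxE !sqrrN; apply/diskE.
  by rewrite /l -w2 !mxE; lra.
have c0 : 0 < c.
  rewrite ltNge; apply/negP => c0.
  have : l (vec2 (1, 0)) <= 3 * c by apply: c3; apply: basis_mem; rewrite expr1n expr0n/= addr0.
  have : l (vec2 (0, 1)) <= 3 * c by apply: c3; apply: basis_mem; rewrite expr1n expr0n/= add0r.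
  have /lD : D (vec2 (1, 0)) by apply: basis_mem; rewrite expr1n expr0n/= addr0.
  have /lD : D (vec2 (0, 1)) by apply: basis_mem; rewrite expr1n expr0n/= add0r.
  have /lD : D (vec2 (0, 0)) by apply: basis_mem; rewrite expr0n/= add0r.
  rewrite /l !vec2E !mulr0 !mulr1 !add0r !addr0 => /andP[h1 _] /andP[h2 _] /andP[h3 _] h4 h5.
  by case/orP: ab0 => /negP; apply; apply/eqP; lra.
(* [s] is the minimum of 1 and [3 c]. The bound by [3 c] makes the relative height of [x] in the
   strip at least a third of its depth; the bound by 1 allows [s] to be dropped under the square
   root at the end. *)
have [s [s0 s1 sc sD]] : exists s : R, [/\ 0 < s, s <= 1, s <= 3 * c &
    forall w, D w -> 0 <= l w <= s].
  have [h|h] := leP (3 * c) 1.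
    exists (3 * c); split=> //; first lra.
    by move=> w Dw; rewrite c3// andbT; case/andP: (lD _ Dw).
  by exists 1; split=> //; first lra.
have lx : d * c <= l x.
  have := deepx (- a) (- b) c _; rewrite /l => h.
  suff : - a * x 0 0 + - b * x 1 0 <= (1 - d) * c by lra.
  by apply: h => w /lD/andP[]; lra.
have lxy : l x = t * l y + (1 - t) * c by rewrite /l xty !mxE; ring.
have /andP[ly0 lys] := sD _ Dy.
have lx0 : 0 <= l x by apply: le_trans lx; rewrite mulr_ge0// ltW.
have v01 : 0 <= l y / s <= 1 
  by rewrite (divr_ge0 ly0 (ltW s0))/= ler_pdivrMr// mul1r.
(* By [lxy], [l x >= t * l y], and [t >= 15/16]. *)
have vv' : l y / s <= 16 / 15 * (l x / s).
  rewrite mulrA ler_pM2r ?invr_gt0//.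
  have e1 : 0 <= (1 - t) * c by rewrite mulr_ge0 ?subr_ge0// ltW.
  have t3 : 15 / 16 <= t by clear -t1 d1; lra.
  have e2 : 0 <= (t - 15 / 16) * l y by rewrite mulr_ge0 ?subr_ge0.
  by clear -e1 e2 lxy; lra.
(* [48 = 16 * 3]: depth gives [l x >= c / (16 n^2)], and [s <= 3 c]. *)
have nv' : 1 <= 48 * n%:R ^+ 2 * (l x / s).
  rewrite mulrA ler_pdivlMr// mul1r.
  have : 48 * n%:R ^+ 2 * (d * c) <= 48 * n%:R ^+ 2 * l x.
    by rewrite ler_wpM2l// mulr_ge0// ltW.
  have -> : 48 * n%:R ^+ 2 * (d * c) = 3 * c * (16 * n%:R ^+ 2 * d) by ring.
  by rewrite dn; lra.
have [p [P [sp Pp pv PP]]] := exists_peak_poly_degree n0 v01 vv' nv'.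
have sp' : (size p <= (2 * (n %/ 4)).+1)%N by rewrite -addn1.
have [g sg gE] := mpoly_linear_comp (a / s) (b / s) (c / s) sp'.
have gE' w : mpeval g w = p.[l w / s] by rewrite gE; congr horner; rewrite /l; ring.
exists s, g, p, P; split=> //.
- by split=> //; rewrite addn1.
- by split=> //; rewrite gE'.
have PP0 : 0 <= P.[1] - P.[0].
  rewrite subr_ge0; apply: (le_of_is_derive_ge0 _ (fun x _ => is_derive_poly P x)); first lra.
  by move=> w _; rewrite Pp horner_exp sqr_ge0.
split=> //; split=> //; apply: le_trans (ler_wpM2l (ltW s0) PP) _.
have sl : s * Num.sqrt (l x / s) <= Num.sqrt (l x).
  have ls0 : 0 <= l x / s by exact: divr_ge0 lx0 (ltW s0).
  have h1 : 0 <= s * Num.sqrt (l x / s) by exact: mulr_ge0 (ltW s0) (sqrtr_ge0 _).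
  rewrite -ler_sqr ?nnegrE ?sqrtr_ge0//.
  rewrite exprMn (sqr_sqrtr ls0) (sqr_sqrtr lx0).
  have -> : s ^+ 2 * (l x / s) = s * l x by field; rewrite gt_eqF.
  by rewrite ler_piMl.
rewrite [leLHS]mulrCA; apply: ler_wpM2l sl.
by apply: mulr_ge0; [exact: mulr_ge0 (ler0n _ _) (ler0n _ _)|rewrite invr_ge0 ler0n].
Qed.

(** One peak for each pair of parallel sides; each has degree at most [2 (n / 4)] with integer
    division, so the product has degree at most [n]. *)
Lemma parallelogram_peak (n : nat) (z : 'cV[R]_2) (A : 'M[R]_2) (t : R) (x y : 'cV[R]_2) :
  (0 < n)%N -> A \in unitmx -> D `<=` affine z A @` square 1 ->
  x = t *: y -> 1 - 2 ^- 4 * n%:R ^- 2 <= t <= 1 -> D y ->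
  deep (2 ^- 4 * n%:R ^- 2) D x ->
  exists f : mpoly 2 R, [/\ (mpoly.msize f <= n.+1)%N, 1 <= mpeval f y &
    integral2 D (fun y => mpeval f y ^+ 2) <= (800 * 117) ^+ 2 * n%:R ^- 2 *
      (Num.sqrt (affine_inv z A x 0 0 * affine_inv z A x 1 0) * `|\det A|)].
Proof.
move=> n0 uA DA xty t1 Dy deepx.
pose B := invmx A.
pose l i (w : 'cV[R]_2) := B i 0 * w 0 0 + B i 1 * w 1 0 - (B i 0 * z 0 0 + B i 1 * z 1 0).
have lE i w : affine_inv z A w i 0 = l i w.
  by rewrite /affine_inv /l mxE sum2 !mxE; ring.
have lD i w : D w -> 0 <= l i w <= 1.
  by move=> /DA[u usq <-]; rewrite -lE affineK.
have B0 i : (B i 0 != 0) || (B i 1 != 0).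
  apply: contraT; rewrite negb_or !negbK => /andP[/eqP b0 /eqP b1].
  have : B \in unitmx by rewrite unitmx_inv.
  rewrite unitmxE unitfE det2.
  have [i0|i1] : i = 0 \/ i = 1.
    by case: (unliftP 0 i) => [j ->|->]; [right; rewrite ord1; apply/val_inj|left].
  - by rewrite i0 in b0 b1; rewrite b0 b1 !mul0r subrr eqxx.
  - by rewrite i1 in b0 b1; rewrite b0 b1 !mulr0 subrr eqxx.
have [s0 [g0 [p0 [P0 [s00 s0D [sg0 Pp0] [g0y g0E] [l0x [P00 P0le]]]]]]] :=
  strip_peak n0 (B0 0) (lD 0) xty t1 Dy deepx.
have [s1 [g1 [p1 [P1 [s10 s1D [sg1 Pp1] [g1y g1E] [_ [P10 P1le]]]]]]] :=
  strip_peak n0 (B0 1) (lD 1) xty t1 Dy deepx.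
exists (g0 * g1).
have fE w : mpeval (g0 * g1) w = mpeval g0 w * mpeval g1 w by rewrite /mpeval mevalM.
split.
- apply: leq_trans (msizeM_pred_le _ _) _.
  move: (leq_add sg0 sg1); move: (_ + _)%N => m; clear; lia.
- by rewrite fE mulr_ege1.
(* The parallelogram with sides shortened by [s0] and [s1]. It still contains [D], and these factors
   of the determinant are those in the bounds [P0le] and [P1le]. *)
pose A' : 'M[R]_2 := \matrix_(i, j) (A i j * (if j == 0 then s0 else s1)).
have detA' : \det A' = s0 * s1 * \det A by rewrite !det2 !mxE /=; ring.
have uA' : A' \in unitmx.
  by rewrite unitmxE detA' unitrM -unitmxE uA andbT unitfE mulf_neq0// gt_eqF.
have affA' w : affine z A' w = affine z A (vec2 (s0 * w 0 0, s1 * w 1 0)).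
  by apply: cV2P; rewrite !mxE !sum2 !mxE /=; ring.
have lA' w : l 0 (affine z A' w) = s0 * w 0 0 /\ l 1 (affine z A' w) = s1 * w 1 0.
  by rewrite -!lE affA' affineK// !vec2E.
apply: le_trans (integral2_product_le (p := p0) (q := p1) (P := P0) (Q := P1)
  compactD Ddisk uA' Pp0 Pp1 _) _.
  move=> w Dw; have [l0w l1w] := lA' w.
  have : 0 <= l 0 (affine z A' w) <= s0 := s0D _ Dw; rewrite l0w => /andP[h1 h2].
  have : 0 <= l 1 (affine z A' w) <= s1 := s1D _ Dw; rewrite l1w => /andP[h3 h4].
  split.
  - by rewrite -(pmulr_rge0 _ s00) h1/= -(ler_pM2l s00) mulr1.
  - by rewrite -(pmulr_rge0 _ s10) h3/= -(ler_pM2l s10) mulr1.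
  have e0 : mpeval g0 (affine z A' w) = p0.[l 0 (affine z A' w) / s0] := g0E _.
  have e1 : mpeval g1 (affine z A' w) = p1.[l 1 (affine z A' w) / s1] := g1E _.
  by rewrite fE e0 e1 l0w l1w ![_ / _]mulrC !mulKf// gt_eqF.
have h := ler_pM (mulr_ge0 (ltW s00) P00) (mulr_ge0 (ltW s10) P10) P0le P1le.
rewrite detA' !normrM (gtr0_norm s00) (gtr0_norm s10).
have -> : s0 * s1 * `|\det A| * ((P0.[1] - P0.[0]) * (P1.[1] - P1.[0])) =
  `|\det A| * (s0 * (P0.[1] - P0.[0]) * (s1 * (P1.[1] - P1.[0]))) by ring.
apply: le_trans (ler_wpM2l _ h) _ => //.
rewrite !lE (sqrtrM _ l0x) -exprVn -/(l 0 _) -/(l 1 _).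
by rewrite le_eqVlt; apply/orP; left; apply/eqP; ring.
Qed.

End Strips.

(** * Comparison of the geometric quantities *)

Section Geometry.
Variables (R : realType) (D : set 'cV[R]_2).
Hypotheses (convD : convex_set D) (compactD : compact D).
Hypotheses (diskD : disk R `<=` D) (Ddisk : D `<=` dilate 2 (disk R)).

Let D0 : D 0.
Proof. by apply: diskD; apply/diskE; rewrite !mxE expr0n/= addr0. Qed.

Definition support (a b : R) : R := sup [set a * y 0 0 + b * y 1 0 | y in D].

Lemma dot_le2 (a b : R) (y : 'cV[R]_2) : a ^+ 2 + b ^+ 2 = 1 -> D y ->
  a * y 0 0 + b * y 1 0 <= 2.
Proof.
move=> ab /Ddisk[w /diskE w1 <-]; rewrite !mxE.
have := sqr_ge0 (a - w 0 0); have := sqr_ge0 (b - w 1 0); nra.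
Qed.

Lemma support_ub (a b : R) (y : 'cV[R]_2) : D y -> a * y 0 0 + b * y 1 0 <= support a b.
Proof.
move=> Dy; apply: ub_le_sup; last by exists y.
exists (`|a| * 2 + `|b| * 2) => _ [w Dw <-].
have [h1 h2] := dilate2_coord Ddisk Dw.
apply: lerD; rewrite (le_trans (ler_norm _))// normrM ler_wpM2l//.
Qed.

Lemma support_le (a b c : R) : (forall y, D y -> a * y 0 0 + b * y 1 0 <= c) ->
  support a b <= c.
Proof.
move=> h; apply: ge_sup.
  by exists (a * (0 : 'cV[R]_2) 0 0 + b * (0 : 'cV[R]_2) 1 0); exists 0.
by move=> _ [y Dy <-]; exact: h.
Qed.

Lemma support_ge1 (a b : R) : a ^+ 2 + b ^+ 2 = 1 -> 1 <= support a b.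
Proof.
move=> ab; have := @support_ub a b (vec2 (a, b)) _; rewrite !vec2E /= -!expr2 ab; apply.
by apply: diskD; apply/diskE; rewrite !vec2E /= ab.
Qed.

(** The normal points from the nearest point [y0] of [D] to [p]. A point [w] of [D] beyond the line
    through [y0] would allow a step from [y0] towards [w] that comes closer to [p]. *)
Lemma separation (p : 'cV[R]_2) : ~ D p ->
  exists a b, a ^+ 2 + b ^+ 2 = 1 /\ support a b < a * p 0 0 + b * p 1 0.
Proof.
move=> Dp; pose f (y : 'cV[R]_2) := (p 0 0 - y 0 0) ^+ 2 + (p 1 0 - y 1 0) ^+ 2.
have cf : continuous f.
  have cg i : continuous (fun y : 'cV[R]_2 => p i 0 - y i 0).
    move=> y; apply: (@continuousB _ _ _ (cst (p i 0)) (fun y : 'cV[R]_2 => y i 0)).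
      exact: cst_continuous.
    exact: coord_continuous.
  by move=> y; apply: (@continuousD _ _ _ (fun y : 'cV[R]_2 => (p 0 0 - y 0 0) ^+ 2)
    (fun y : 'cV[R]_2 => (p 1 0 - y 1 0) ^+ 2)); apply: continuousM; exact: cg.
have [y0 Dy0 ymin] : exists2 y, D y & forall w, D w -> f y <= f w.
  have [y Dy ymin] := @compact_EVT_min _ R f D (ex_intro _ 0 D0) compactD
    (continuous_subspaceT cf).
  by exists y; rewrite ?inE in Dy * => // w Dw; apply: ymin; rewrite inE.
pose u0 := p 0 0 - y0 0 0; pose u1 := p 1 0 - y0 1 0; pose r := Num.sqrt (u0 ^+ 2 + u1 ^+ 2).
have r2 : r ^+ 2 = u0 ^+ 2 + u1 ^+ 2 by rewrite sqr_sqrtr// addr_ge0 ?sqr_ge0.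
have r0 : 0 < r.
  rewrite lt_neqAle sqrtr_ge0 andbT eq_sym; apply/eqP => r0; apply: Dp.
  have := r2; rewrite r0 expr0n/= => /esym h.
  have h0 : u0 ^+ 2 = 0 by have := sqr_ge0 u0; have := sqr_ge0 u1; lra.
  have h1 : u1 ^+ 2 = 0 by have := sqr_ge0 u0; have := sqr_ge0 u1; lra.
  rewrite (_ : p = y0)//; apply: cV2P; apply/eqP; rewrite -subr_eq0 -sqrf_eq0.
    by rewrite -/u0 h0.
  by rewrite -/u1 h1.
have hu w : D w -> u0 * w 0 0 + u1 * w 1 0 <= u0 * y0 0 0 + u1 * y0 1 0.
  move=> Dw; rewrite leNgt; apply/negP => lt_w.
  pose s0 := w 0 0 - y0 0 0; pose s1 := w 1 0 - y0 1 0.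
  have us : 0 < u0 * s0 + u1 * s1 by rewrite /s0 /s1; lra.
  (* With this denominator the step [t] is at most 1 and [t |s|^2] is at most the scalar product of
     [u] and [s], less than the twice that product gained. *)
  pose q := s0 ^+ 2 + s1 ^+ 2 + (u0 * s0 + u1 * s1).
  have q0 : 0 < q by rewrite /q ltr_wpDl// addr_ge0 ?sqr_ge0.
  pose t := (u0 * s0 + u1 * s1) / q.
  have t0 : 0 < t by rewrite divr_gt0.
  have t1 : t <= 1 by rewrite ler_pdivrMr// mul1r /q; have := sqr_ge0 s0; have := sqr_ge0 s1; lra.
  have tq : t * q = u0 * s0 + u1 * s1 by rewrite /t divfK// gt_eqF.
  have Dt : D (t *: w + (1 - t) *: y0) by apply: convex_mem => //; rewrite (ltW t0).
  have := ymin _ Dt; rewrite /f !mxE.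
  rewrite (_ : p 0 0 - (t * w 0 0 + (1 - t) * y0 0 0) = u0 - t * s0); last by rewrite /u0 /s0; ring.
  rewrite (_ : p 1 0 - (t * w 1 0 + (1 - t) * y0 1 0) = u1 - t * s1); last by rewrite /u1 /s1; ring.
  rewrite -/u0 -/u1 -subr_ge0.
  rewrite (_ : _ - _ = t * (t * (s0 ^+ 2 + s1 ^+ 2) - 2 * (u0 * s0 + u1 * s1))); last by ring.
  rewrite pmulr_rge0//.
  have : t * (s0 ^+ 2 + s1 ^+ 2) <= t * q.
    by rewrite ler_wpM2l ?(ltW t0)// /q lerDl ltW.
  by lra.
exists (u0 / r), (u1 / r); split.
  by rewrite !expr_div_n -mulrDl -r2 divff// sqrf_eq0 gt_eqF.
apply: le_lt_trans (_ : (u0 * y0 0 0 + u1 * y0 1 0) / r < _).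
  apply: support_le => w Dw.
  rewrite (_ : _ + _ = (u0 * w 0 0 + u1 * w 1 0) / r); last by ring.
  by rewrite ler_pM2r ?invr_gt0// hu.
rewrite [ltRHS](_ : _ = (u0 * p 0 0 + u1 * p 1 0) / r); last by ring.
rewrite ltr_pM2r ?invr_gt0// -subr_gt0.
rewrite (_ : _ - _ = u0 ^+ 2 + u1 ^+ 2); last by rewrite /u0 /u1; ring.
by rewrite -r2 exprn_gt0.
Qed.

Variable (x : 'cV[R]_2).
Hypothesis Dx : D x.

Definition gap (a b : R) : R := support a b - (a * x 0 0 + b * x 1 0).

Lemma gap_ge0 (a b : R) : 0 <= gap a b.
Proof. by rewrite subr_ge0 support_ub. Qed.

Lemma gap_le4 (a b : R) : a ^+ 2 + b ^+ 2 = 1 -> gap a b <= 4.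
Proof.
move=> ab; have h1 : support a b <= 2 by apply: support_le => y; exact: dot_le2.
have := @dot_le2 (- a) (- b) x; rewrite !sqrrN => /(_ ab Dx); rewrite /gap; lra.
Qed.

(* The parallelogram bounded by two supporting lines of [D] and their translates
   at distance 8. *)
Lemma exists_parallelogram (a b c d : R) : a ^+ 2 + b ^+ 2 = 1 -> c ^+ 2 + d ^+ 2 = 1 ->
  a * d - b * c != 0 -> exists (z : 'cV[R]_2) (A : 'M[R]_2),
  [/\ A \in unitmx, (affine z A @` square 2^-1) x, D `<=` affine z A @` square 1 &
    8 * Num.sqrt (gap a b * gap c d) / `|a * d - b * c| =
      Num.sqrt (affine_inv z A x 0 0 * affine_inv z A x 1 0) * `|\det A|].
Proof.
move=> ab cd n0.
(* [B] is the inverse of the linear part: the new coordinates are the distances to the two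
   supporting lines divided by 8. As [D] has width at most 4 they are at most 1/2, so [x] lies in
   the required quarter. *)
pose B : 'M[R]_2 := \matrix_(i, j)
  (- (if i == 0 then if j == 0 then a else b else if j == 0 then c else d) / 8).
have detB : \det B = (a * d - b * c) / 64 by rewrite det2 !mxE /=; field.
have uB : B \in unitmx by rewrite unitmxE unitfE detB mulf_neq0.
pose v : 'cV[R]_2 := vec2 (support a b / 8, support c d / 8).
pose A := invmx B; pose z := - (A *m v).
have uA : A \in unitmx by rewrite unitmx_inv.
have invE y : affine_inv z A y = vec2 ((support a b - (a * y 0 0 + b * y 1 0)) / 8,
    (support c d - (c * y 0 0 + d * y 1 0)) / 8).
  rewrite /affine_inv /A invmxK /z opprK mulmxDr mulKVmx//.
  by apply: cV2P; rewrite !mxE sum2 !mxE /=; field.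
have bnd (a' b' : R) y : a' ^+ 2 + b' ^+ 2 = 1 -> D y ->
    0 <= (support a' b' - (a' * y 0 0 + b' * y 1 0)) / 8 <= 2^-1.
  move=> ab' Dy; have h1 := support_ub a' b' Dy.
  have h2 : support a' b' <= 2 by apply: support_le => w; exact: dot_le2.
  have := @dot_le2 (- a') (- b') y; rewrite !sqrrN => /(_ ab' Dy) h3.
  by apply/andP; split; lra.
have sq (w : 'cV[R]_2) (s : R) : 0 <= w 0 0 <= s -> 0 <= w 1 0 <= s -> square s w.
  move=> h0 h1 i; case: (unliftP 0 i) => [j ->|->//].
  by rewrite ord1 (_ : lift 0 0 = 1)//; apply/val_inj.
exists z, A; split=> //.
- exists (affine_inv z A x); last exact: affine_invK.
  by rewrite invE; apply: sq; rewrite !vec2E /=; exact: bnd.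
- move=> y Dy; exists (affine_inv z A y); last exact: affine_invK.
  rewrite invE; apply: sq; rewrite !vec2E /=.
    by have /andP[-> h] := bnd a b y ab Dy; lra.
  by have /andP[-> h] := bnd c d y cd Dy; lra.
rewrite invE !vec2E /= -/(gap a b) -/(gap c d) /A det_inv detB normfV normrM.
have -> : gap a b / 8 * (gap c d / 8) = (gap a b * gap c d) * (8^-1) ^+ 2 by ring.
have gg0 : 0 <= gap a b * gap c d by rewrite mulr_ge0 ?gap_ge0.
rewrite [in RHS](sqrtrM _ gg0) sqrtr_sqr.
rewrite (ger0_norm (_ : 0 <= 8^-1))// (ger0_norm (_ : 0 <= 64^-1))//.
by field; rewrite normr_eq0.
Qed.

Lemma geomU_le_gap (a b c d : R) : a ^+ 2 + b ^+ 2 = 1 -> c ^+ 2 + d ^+ 2 = 1 ->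
  geomU x D * `|a * d - b * c| <= 8 * Num.sqrt (gap a b * gap c d).
Proof.
move=> ab cd; have [->|n0] := eqVneq (a * d - b * c) 0.
  by rewrite normr0 mulr0 mulr_ge0// sqrtr_ge0.
have [z [A [uA Ax DA vE]]] := exists_parallelogram ab cd n0.
rewrite -ler_pdivlMr ?normr_gt0//; apply: ge_inf; last by exists z, A.
by exists 0 => _ [z' [A' [_ _ _ ->]]]; rewrite mulr_ge0// sqrtr_ge0.
Qed.

(** The left side is the support function of the ellipse. A point of the ellipse outside [D] would
    be separated from [D], against Cauchy-Schwarz. *)
Lemma disk_image_sub (z : 'cV[R]_2) (A : 'M[R]_2) :
  (forall a b, a ^+ 2 + b ^+ 2 = 1 ->
    a * z 0 0 + b * z 1 0 + Num.sqrt ((a * A 0 0 + b * A 1 0) ^+ 2 +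
      (a * A 0 1 + b * A 1 1) ^+ 2) <= support a b) ->
  affine z A @` disk R `<=` D.
Proof.
move=> h _ [w /diskE w1 <-]; apply: contrapT => /separation[a [b [ab]]].
apply/negP; rewrite -leNgt; apply: le_trans (h a b ab).
set u0 := _ * A 0 0 + _; set u1 := _ * A 0 1 + _.
rewrite !mxE !sum2.
rewrite [leLHS](_ : _ = a * z 0 0 + b * z 1 0 + (u0 * w 0 0 + u1 * w 1 0)); last first.
  by rewrite /u0 /u1; ring.
rewrite lerD2l; set r := u0 * _ + _; have [r0|r0] := leP r 0.
  by rewrite (le_trans r0)// sqrtr_ge0.
rewrite -(ger0_norm (ltW r0)) -sqrtr_sqr ler_sqrt ?addr_ge0 ?sqr_ge0//.
have -> : r ^+ 2 = (u0 ^+ 2 + u1 ^+ 2) * (w 0 0 ^+ 2 + w 1 0 ^+ 2) -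
  (u0 * w 1 0 - u1 * w 0 0) ^+ 2 by rewrite /r; ring.
rewrite lerBlDr (le_trans (_ : _ <= (u0 ^+ 2 + u1 ^+ 2) * 1))//; last first.
  by rewrite mulr1 lerDl sqr_ge0.
by rewrite ler_wpM2l// addr_ge0 ?sqr_ge0.
Qed.

End Geometry.

Section InscribedEllipse.
Variables (R : realType) (D : set 'cV[R]_2).
Hypotheses (convD : convex_set D) (compactD : compact D).
Hypotheses (diskD : disk R `<=` D) (Ddisk : D `<=` dilate 2 (disk R)).
Variable (x : 'cV[R]_2).
Hypothesis Dx : D x.

(* For a unit normal, [s] is its product with [x] and [g] the distance from [x] to
   the supporting line; [s / 32] and [q m] are its products with the two semi-axes,
   and the ellipse is centred at [(1 - 1 / 32 + d / 8) x]. *)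
Lemma ellipse_support_le (s g d q m : R) : -2 <= s <= 2 -> 0 <= d <= 1 / 4 ->
  d / 2 <= g -> 1 - s <= g -> (q * m) ^+ 2 <= g / 64 -> (q * m) ^+ 2 <= 1 / 16 ->
  (1 - 1 / 32 + d / 8) * s + Num.sqrt ((s / 32) ^+ 2 + (q * m) ^+ 2) <= s + g.
Proof.
move=> /andP[s1 s2] /andP[d0 d1] gd gs q1 q2.
have ds : `|d * s| <= 2 * d.
  by rewrite normrM (ger0_norm d0) [leLHS]mulrC ler_wpM2r// ler_norml s1.
move: ds; rewrite ler_norml => /andP[ds1 ds2].
pose T := g + s / 32 - d * s / 8.
have T0 : 0 <= T by rewrite /T; lra.
suff h : Num.sqrt ((s / 32) ^+ 2 + (q * m) ^+ 2) <= T by rewrite /T in h; lra.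
rewrite -(ger0_norm T0) -sqrtr_sqr ler_sqrt ?sqr_ge0//.
(* For [s >= 1/2] the cross term of [T^2] is at least [g / 64], which covers [(q m)^2]. For smaller
   [s] the line is far, [g >= 1 - s], and the bound [1/16] on [(q m)^2] suffices. *)
have [hs|hs] := leP (1 / 2) s.
  pose k := g - d * s / 8; have k0 : g / 2 <= k by rewrite /k; lra.
  have -> : T ^+ 2 = (s / 32) ^+ 2 + s / 16 * k + k ^+ 2 by rewrite /T /k; field.
  have : 1 / 2 * (g / 2) <= s * k by apply: ler_pM => //; lra.
  have := sqr_ge0 k; lra.
have [hs0|hs0] := leP 0 s.
  have ds3 : d * s <= d * (1 / 2) by rewrite ler_wpM2l// ltW.
  have hT : s / 32 + 31 / 64 <= T by rewrite /T; lra.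
  have h0 : 0 <= s / 32 + 31 / 64 by lra.
  have : (s / 32 + 31 / 64) ^+ 2 <= T ^+ 2 by rewrite ler_sqr ?nnegrE.
  by rewrite !expr2; nra.
have hT : 15 / 16 <= T by rewrite /T; nra.
have : (15 / 16) ^+ 2 <= T ^+ 2 by rewrite ler_sqr ?nnegrE//; lra.
have : s ^+ 2 <= 4 by nra.
by rewrite exprMn; lra.
Qed.

Lemma exists_ellipse (e : R) : 0 < e -> deep e D x ->
  exists (z : 'cV[R]_2) (A : 'M[R]_2),
  [/\ A \in unitmx, (affine z A @` disk R) x, affine z A @` disk R `<=` D &
    geomU x D <= 2048 * (Num.sqrt (1 - enorm (affine_inv z A x)) * `|\det A|)].
Proof.
move=> e0 deepx.
pose G := gap D x; pose S := [set v | exists a b, a ^+ 2 + b ^+ 2 = 1 /\ v = G a b].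
have Ge a b : a ^+ 2 + b ^+ 2 = 1 -> e <= G a b.
  move=> ab; have h1 := support_ge1 diskD Ddisk ab.
  have := deepx a b (support D a b) (fun y => support_ub Ddisk a b (y := y)).
  by rewrite /G /gap; nra.
have S1 : has_inf S.
  split; first by exists (G 1 0), 1, 0; rewrite expr1n expr0n addr0.
  by exists e => _ [a [b [ab ->]]]; exact: Ge.
have i0 : 0 < inf S.
  apply: lt_le_trans e0 _; apply: lb_le_inf; first by case: S1.
  by move=> _ [a [b [ab ->]]]; exact: Ge.
have [_ [a0 [b0 [ab0 ->]]] d2] := inf_adherent i0 S1.
have Gi a b : a ^+ 2 + b ^+ 2 = 1 -> inf S <= G a b.
  by move=> ab; apply: ge_inf; [case: S1|exists a, b].
pose d := G a0 b0.
have di : inf S <= d by exact: Gi.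
have d0 : 0 < d by exact: lt_le_trans di.
have Gd a b : a ^+ 2 + b ^+ 2 = 1 -> d / 2 <= G a b.
  by move=> /Gi h; rewrite -/d in d2; lra.
have dot2 a b : a ^+ 2 + b ^+ 2 = 1 -> -2 <= a * x 0 0 + b * x 1 0 <= 2.
  move=> ab; rewrite (dot_le2 Ddisk ab Dx) andbT.
  have := @dot_le2 R D Ddisk (- a) (- b) x; rewrite !sqrrN => /(_ ab Dx); lra.
(* Far from the boundary the disk of radius 1/8 about [x] fits, and [U <= 8 * 4 = 2048 / 64]. *)
have [d14|d14] := leP d (1 / 4); last first.
  have uA : (8^-1)%:M \in @unitmx R 2 by rewrite unitmxE det_scalar unitfE expf_neq0// invr_eq0.
  have invx : affine_inv x (8^-1)%:M x = 0 by rewrite /affine_inv subrr mulmx0.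
  exists x, (8^-1)%:M; split=> //.
  - exists 0; last by rewrite /affine mulmx0 addr0.
    by apply/diskE; rewrite !mxE expr0n/= addr0.
  - apply: (disk_image_sub convD compactD diskD) => a b ab.
    rewrite !mxE /= !mulr1n !mulr0n !mulr0 addr0 add0r.
    rewrite (_ : _ ^+ 2 + _ ^+ 2 = 8^-1 ^+ 2); last by rewrite !exprMn -mulrDl ab mul1r.
    rewrite sqrtr_sqr ger0_norm//; have := Gd _ _ ab; rewrite /G /gap; lra.
  rewrite invx enormE !mxE expr0n/= addr0 sqrtr0 subr0 sqrtr1 mul1r det_scalar.
  have := geomU_le_gap diskD Ddisk Dx (a := 1) (b := 0) (c := 0) (d := 1).
  rewrite !expr1n !expr0n/= addr0 add0r mulr1 mul0r subr0 normr1 mulr1 => /(_ erefl erefl).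
  have g1 : gap D x 1 0 <= 4 by apply: (gap_le4 diskD Ddisk Dx); rewrite expr1n expr0n addr0.
  have g2 : gap D x 0 1 <= 4 by apply: (gap_le4 diskD Ddisk Dx); rewrite expr1n expr0n add0r.
  have s4 : Num.sqrt (gap D x 1 0 * gap D x 0 1) <= 4.
    rewrite -[leRHS]ger0_norm// -sqrtr_sqr ler_sqrt ?sqr_ge0// expr2.
    by apply: ler_pM => //; exact: gap_ge0.
  have -> : `|8^-1 ^+ 2| = 64^-1 :> R by rewrite ger0_norm ?sqr_ge0//; field.
  lra.
(* [U / 8] is the coefficient provided by the pairs of supporting lines; the maximum with [d / 2]
   keeps [a] positive, so that the ellipse is not degenerate. *)
pose a := Num.max (geomU x D / 8) (d / 2).
have ad : d / 2 <= a by rewrite /a le_max lexx orbT.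
have aU : geomU x D <= 8 * a.
  have : geomU x D / 8 <= a by rewrite /a le_max lexx.
  by clear; lra.
have a_gt0 : 0 < a by apply: lt_le_trans ad; rewrite divr_gt0.
have aG a' b' : a' ^+ 2 + b' ^+ 2 = 1 -> a ^+ 2 * (a0 * b' - b0 * a') ^+ 2 <= d * G a' b'.
  move=> ab'; rewrite /a maxEle; case: ifPn => [_|]; last first.
    rewrite -ltNge => Ud.
    have := geomU_le_gap diskD Ddisk Dx ab0 ab'; rewrite -/G -/d => h.
    have U0 : 0 <= geomU x D * `|a0 * b' - b0 * a'| by rewrite mulr_ge0//; lra.
    have : (geomU x D * `|a0 * b' - b0 * a'|) ^+ 2 <= (8 * Num.sqrt (d * G a' b')) ^+ 2.
      by rewrite ler_sqr ?nnegrE// mulr_ge0 ?sqrtr_ge0.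
    rewrite !exprMn real_normK ?num_real// sqr_sqrtr; last first.
      exact: mulr_ge0 (ltW d0) (gap_ge0 Ddisk Dx _ _).
    rewrite -(ler_pM2l (_ : 0 < 64 :> R))//.
    rewrite (_ : 64 * _ = geomU x D ^+ 2 * (a0 * b' - b0 * a') ^+ 2); last by field.
    by rewrite (_ : 64 = 8 ^+ 2)//; ring.
  have m1 : (a0 * b' - b0 * a') ^+ 2 <= 1.
    rewrite -subr_ge0 (_ : _ - _ = (a0 * a' + b0 * b') ^+ 2) ?sqr_ge0//.
    have -> : 1 = (a0 ^+ 2 + b0 ^+ 2) * (a' ^+ 2 + b' ^+ 2) :> R by rewrite ab0 ab' mulr1.
    by ring.
  have := Gd _ _ ab'; have := sqr_ge0 (a0 * b' - b0 * a'); move: (_ ^+ 2) m1 => m m1 m0 gd.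
  apply: le_trans (_ : d * (d / 2) <= _); last by rewrite ler_wpM2l// ltW.
  rewrite (_ : (d / 2) ^+ 2 * m = d * (d / 2) * (m / 2)); last by field.
  by rewrite ler_piMr ?mulr_ge0 ?divr_ge0 ?ltW//; lra.
(* The quadratic bound at the normal orthogonal to [(a0, b0)], where the gap is at most 4. *)
have a4 : a ^+ 2 <= 4 * d.
  have h : (- b0) ^+ 2 + a0 ^+ 2 = 1 by rewrite sqrrN addrC.
  have := aG _ _ h; have := gap_le4 diskD Ddisk Dx h; rewrite -/G.
  rewrite mulrN opprK -!expr2 ab0 expr1n mulr1 => g4 h'.
  by apply: le_trans h' _; rewrite mulrC ler_wpM2r// ltW.
pose r := Num.sqrt d; have r0 : 0 < r by rewrite sqrtr_gt0.
have r2 : r ^+ 2 = d by rewrite sqr_sqrtr// ltW.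
(* Chosen so that [aG] becomes [(q m)^2 <= G / 64], the hypothesis of [ellipse_support_le]. *)
pose q := a / (8 * r).
have q0 : 0 < q by rewrite divr_gt0// mulr_gt0.
have q2 : q ^+ 2 = a ^+ 2 / (64 * d).
  by rewrite /q -r2; field; rewrite gt_eqF.
(* Conjugate semi-axes: [x / 32], and length [q] along the nearly closest supporting line. *)
pose A : 'M[R]_2 := \matrix_(i, j)
  (if j == 0 then x i 0 / 32 else if i == 0 then - (q * b0) else q * a0).
pose c0 := a0 * x 0 0 + b0 * x 1 0.
have c034 : 3 / 4 <= c0.
  have h1 := support_ge1 diskD Ddisk ab0.
  have : c0 = support D a0 b0 - d by rewrite /d /G /gap /c0; ring.
  lra.
have detA : \det A = q * c0 / 32 by rewrite det2 !mxE /= /c0; field.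
have detA0 : 0 < \det A by rewrite detA divr_gt0// mulr_gt0//; lra.
have uA : A \in unitmx by rewrite unitmxE unitfE gt_eqF.
pose z := (1 - 1 / 32 + d / 8) *: x.
(* The centre was chosen to make [1 - |w| = 4 d]: the factor [2 sqrt d] then cancels the [sqrt d] in
   [q], and the value of the ellipse is of order [a]. *)
pose w : 'cV[R]_2 := vec2 (1 - 4 * d, 0).
have xw : affine z A w = x.
  by apply: cV2P; rewrite !mxE sum2 !mxE /=; field.
have w1 : enorm w = 1 - 4 * d.
  by rewrite enormE !vec2E /= expr0n addr0 sqrtr_sqr ger0_norm//; lra.
exists z, A; split=> //.
- exists w => //; rewrite /disk/= w1; lra.
- apply: (disk_image_sub convD compactD diskD) => a' b' ab'.
  set s := a' * x 0 0 + b' * x 1 0; pose m := a0 * b' - b0 * a'.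
  have -> : a' * z 0 0 + b' * z 1 0 = (1 - 1 / 32 + d / 8) * s by rewrite !mxE /s; ring.
  have -> : a' * A 0 0 + b' * A 1 0 = s / 32 by rewrite !mxE /= /s; ring.
  have -> : a' * A 0 1 + b' * A 1 1 = q * m by rewrite !mxE /= /m; ring.
  have -> : support D a' b' = s + G a' b' by rewrite /G /gap /s; ring.
  have gs : 1 - s <= G a' b' by have := support_ge1 diskD Ddisk ab'; rewrite /G /gap -/s; lra.
  have qm : (q * m) ^+ 2 = a ^+ 2 * m ^+ 2 / (64 * d).
    by rewrite exprMn q2; ring.
  have d64 : 0 < 64 * d by rewrite mulr_gt0.
  have hm := aG _ _ ab'; rewrite -/m in hm.
  apply: ellipse_support_le => //; [exact: dot2|by rewrite (ltW d0)|exact: Gd| |].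
    by rewrite qm ler_pdivrMr//; lra.
  rewrite qm ler_pdivrMr//.
  have m1 : m ^+ 2 <= 1.
    rewrite -subr_ge0 (_ : _ - _ = (a0 * a' + b0 * b') ^+ 2) ?sqr_ge0//.
    have -> : 1 = (a0 ^+ 2 + b0 ^+ 2) * (a' ^+ 2 + b' ^+ 2) :> R by rewrite ab0 ab' mulr1.
    by rewrite /m; ring.
  have : a ^+ 2 * m ^+ 2 <= a ^+ 2 * 1 by rewrite ler_wpM2l ?sqr_ge0.
  lra.
rewrite -[in affine_inv _ _ _]xw affineK// w1 gtr0_norm// detA opprB addrC subrK.
have -> : Num.sqrt (4 * d) = 2 * r.
  rewrite -r2 (_ : 4 * r ^+ 2 = (2 * r) ^+ 2); last by ring.
  by rewrite sqrtr_sqr ger0_norm// mulr_ge0// ltW.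
have -> : 2048 * (2 * r * (q * c0 / 32)) = 16 * a * c0.
  by rewrite /q; field; rewrite gt_eqF.
have : a * (3 / 4) <= a * c0 by rewrite ler_wpM2l// ltW.
lra.
Qed.

End InscribedEllipse.

(** * The main estimates *)

Section Main.
Variables (R : realType) (D : set 'cV[R]_2).
Hypotheses (convD : convex_set D) (compactD : compact D).
Hypotheses (diskD : disk R `<=` D) (Ddisk : D `<=` dilate 2 (disk R)).

Lemma tauP (n : nat) (x : 'cV[R]_2) : (0 < n)%N -> D x ->
  exists t : R, [/\ tau n D x = t *: x, 1 - 2 ^- 4 * n%:R ^- 2 <= t <= 1 &
    deep (2 ^- 4 * n%:R ^- 2) D (tau n D x)].
Proof.
move=> n0 Dx; rewrite /tau.
pose d : R := 2 ^- 4 * n%:R ^- 2.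
have n2 : 1 <= n%:R ^+ 2 :> R by rewrite expr_ge1// ler1n.
have d0 : 0 <= d by rewrite mulr_ge0// invr_ge0 exprn_ge0.
have d1 : d < 1.
  rewrite /d -invfM invf_lt1; first by nra.
  by rewrite mulr_gt0// (lt_le_trans ltr01).
have e0 : 0 < 1 - d by rewrite subr_gt0.
rewrite -/d; pose Dn := dilate (1 - d) D.
have dotZ (a b s : R) (y : 'cV[R]_2) :
    a * (s *: y) 0 0 + b * (s *: y) 1 0 = s * (a * y 0 0 + b * y 1 0).
  by rewrite !mxE; ring.
have Dn_dot (y : 'cV[R]_2) a b c : (forall w, D w -> a * w 0 0 + b * w 1 0 <= c) -> Dn y ->
    a * y 0 0 + b * y 1 0 <= (1 - d) * c.
  by move=> h [w /h hw <-]; rewrite dotZ ler_pM2l.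
case: asboolP => Dnx.
  exists 1; rewrite scale1r lexx andbT lerBlDr lerDl; split=> //.
  by move=> a b c h; exact: Dn_dot.
pose S : set R := [set t | 0 < t /\ Dn (t *: x)].
have S1 : S (1 - d) by split=> //; exists x.
have Sub : ubound S 1.
  move=> t [t0 [y Dy yt]]; rewrite leNgt; apply/negP => t1; apply: Dnx.
  exists (t^-1 *: y).
    by apply: (dilate_mem convD diskD) => //; rewrite invr_ge0 ltW//= invf_le1// ltW.
  by rewrite scalerA mulrC -scalerA yt scalerA mulVf ?scale1r// gt_eqF.
have Sn0 : S !=set0 by exists (1 - d).
have s1 : 1 - d <= sup S by apply: ub_le_sup => //; exists 1.
exists (sup S); split=> //; first by rewrite s1 ge_sup.
move=> a b c h.
rewrite dotZ.
set v := a * x 0 0 + b * x 1 0; have hx : v <= c by exact: h.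
have [v0|v0] := leP v 0.
  apply: le_trans (_ : (1 - d) * v <= _); first by rewrite ler_wnM2r.
  by rewrite ler_pM2l.
(* For [v > 0] the inequality is an upper bound on each admissible factor, so it passes to the
   supremum. *)
rewrite -ler_pdivlMr//; apply: ge_sup => // t [t0 Dnt].
by rewrite ler_pdivlMr// /v -dotZ; exact: Dn_dot.
Qed.

Let closedD : closed D.
Proof. exact: compact_closed (@norm_hausdorff _ _) compactD. Qed.

Lemma integral2_sqr_ge0 (f : mpoly 2 R) : 0 <= integral2 D (fun y => mpeval f y ^+ 2).
Proof.
rewrite -lee_fin integral2_sqrE//; apply: integral_ge0 => p _.
by rewrite patchE; case: ifP => // _; rewrite lee_fin sqr_ge0.
Qed.

Lemma integral2_sqr_le (f g : mpoly 2 R) :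
  (forall y, D y -> mpeval f y ^+ 2 <= mpeval g y ^+ 2) ->
  integral2 D (fun y => mpeval f y ^+ 2) <= integral2 D (fun y => mpeval g y ^+ 2).
Proof.
move=> fg; rewrite -lee_fin !integral2_sqrE// -!integral_mkcond.
apply: ge0_le_integral => //.
- exact: measurable_vec2_preimage.
- by move=> p _; rewrite lee_fin sqr_ge0.
- apply: measurable_funTS; apply/measurable_EFinP; apply: measurable_funX.
  exact: measurable_mpeval.
- apply: measurable_funTS; apply/measurable_EFinP; apply: measurable_funX.
  exact: measurable_mpeval.
- by move=> p Dp; rewrite lee_fin fg.
Qed.

Let admissible (n : nat) (x : 'cV[R]_2) : set R :=
  [set v | exists f : mpoly 2 R, [/\ (mpoly.msize f <= n.+1)%N, `|mpeval f x| = 1 &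
     v = integral2 D (fun y => mpeval f y ^+ 2)]].

Let admissible_nonempty (n : nat) (x : 'cV[R]_2) : admissible n x !=set0.
Proof.
exists (integral2 D (fun y => mpeval (mpolyC 2 1 : mpoly 2 R) y ^+ 2)), (mpolyC 2 1).
by rewrite msizeC oner_eq0 /mpeval mevalC normr1.
Qed.

Lemma christoffel_ge (n : nat) (x : 'cV[R]_2) (v : R) :
  (forall f : mpoly 2 R, (mpoly.msize f <= n.+1)%N -> `|mpeval f x| = 1 ->
     v <= integral2 D (fun y => mpeval f y ^+ 2)) -> v <= christoffel n x D.
Proof.
by move=> h; apply: lb_le_inf (admissible_nonempty n x) _ => _ [f [sf f1 ->]]; exact: h.
Qed.

(** The peaks are only known to be at least 1 at the point; normalizing them decreases the
    integral. *)
Lemma christoffel_le (n : nat) (x : 'cV[R]_2) (f : mpoly 2 R) :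
  (mpoly.msize f <= n.+1)%N -> 1 <= mpeval f x ->
  christoffel n x D <= integral2 D (fun y => mpeval f y ^+ 2).
Proof.
move=> sf f1; pose c := (mpeval f x)^-1.
have f0 : 0 < mpeval f x by exact: lt_le_trans f1.
have cE y : mpeval (c *: f) y = c * mpeval f y by rewrite /mpeval mevalZ.
apply: le_trans (_ : integral2 D (fun y => mpeval (c *: f) y ^+ 2) <= _).
  apply: ge_inf; first by exists 0 => _ [g [_ _ ->]]; exact: integral2_sqr_ge0.
  exists (c *: f); split=> //; first by rewrite (leq_trans (msizeZ_le _ _)).
  by rewrite cE /c mulVf ?normr1// gt_eqF.
apply: integral2_sqr_le => y _; rewrite cE exprMn ler_piMl ?sqr_ge0//.
by rewrite expr_le1 /c ?invr_ge0 ?(ltW f0)// invf_le1.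
Qed.

(** The two claims support each other: the supremum dominates a given ellipse only once [Lset] is
    bounded, which is the first estimate, and the ellipse of the second one shows that [Lset] is
    nonempty. *)
Lemma christoffel_ge_geomL (n : nat) (x : 'cV[R]_2) : (0 < n)%N -> D x ->
  geomL (tau n D x) D <= 128 * christoffel_const R ^+ 2 * n%:R ^+ 2 * christoffel n x D /\
  geomU (tau n D x) D <= 2048 * geomL (tau n D x) D.
Proof.
move=> n0 Dx; have [t [tx t1 deept]] := tauP n0 Dx.
set y := tau n D x in tx deept *.
pose Lset := [set v | exists (z : 'cV[R]_2) (A : 'M[R]_2),
  [/\ A \in unitmx, (affine z A @` disk R) y, affine z A @` disk R `<=` D &
    v = Num.sqrt (1 - enorm (affine_inv z A y)) * `|\det A|]].
have nR : 0 < n%:R :> R by rewrite ltr0n.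
have n2 : 0 < n%:R ^+ 2 :> R by rewrite exprn_gt0.
have K0 := christoffel_const_gt0 R.
have C0 : 0 < 128 * christoffel_const R ^+ 2 * n%:R ^+ 2.
  by rewrite !mulr_gt0// ltr0n.
(* [128 = 64 * 2], the 2 coming from the doubled degree along the parabola. *)
have Lub : ubound Lset (128 * christoffel_const R ^+ 2 * n%:R ^+ 2 * christoffel n x D).
  move=> _ [z [A [uA [w w1 yw] AD ->]]].
  rewrite -ler_pdivrMl//; apply: christoffel_ge => f sf f1.
  rewrite ler_pdivrMl//.
  have := mpeval_ray_le convD compactD diskD Ddisk n0 sf uA AD w1 (esym yw) tx t1.
  rewrite -(real_normK (num_real (mpeval f x))) f1 expr1n mul1r -yw affineK// => h.
  apply: le_trans h _; rewrite natrM le_eqVlt; apply/orP; left; apply/eqP; ring.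
have Dy : D y.
  rewrite tx; apply: (dilate_mem convD diskD) => //.
  case/andP: t1 => t1 ->; rewrite andbT (le_trans _ t1)// subr_ge0 -invfM invf_le1//.
    have : 1 <= n%:R ^+ 2 :> R by rewrite expr_ge1// ler1n.
    by nra.
  by rewrite mulr_gt0.
have e0 : 0 < 2 ^- 4 * n%:R ^- 2 :> R by rewrite mulr_gt0// invr_gt0.
have [z [A [uA Ay AD Uv]]] := exists_ellipse convD compactD diskD Ddisk Dy e0 deept.
have Lv : Lset (Num.sqrt (1 - enorm (affine_inv z A y)) * `|\det A|) by exists z, A.
split; first by apply: ge_sup; [exists (Num.sqrt (1 - enorm (affine_inv z A y)) * `|\det A|)|].
apply: le_trans Uv _; apply: (ler_wpM2l (ler0n R 2048)).
by apply: (ub_le_sup _ Lv); exact: (ex_intro _ _ Lub).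
Qed.

Lemma christoffel_le_geomU (n : nat) (x : 'cV[R]_2) : (0 < n)%N -> D x ->
  christoffel n x D <= (800 * 117) ^+ 2 * n%:R ^- 2 * geomU (tau n D x) D.
Proof.
move=> n0 Dx; have [t [tx t1 deept]] := tauP n0 Dx.
set y := tau n D x in tx deept *.
have nR : 0 < n%:R :> R by rewrite ltr0n.
have [C C_gt0 CE] : exists2 C : R, 0 < C & (800 * 117) ^+ 2 = C.
  by eexists; last reflexivity; apply: exprn_gt0; apply: mulr_gt0; rewrite ltr0n.
have C0 : 0 < C * n%:R ^- 2 by apply: mulr_gt0 C_gt0 _; rewrite invr_gt0 exprn_gt0.
have Dy : D y.
  rewrite tx; apply: (dilate_mem convD diskD) => //.
  case/andP: t1 => t1 ->; rewrite andbT (le_trans _ t1)// subr_ge0 -invfM invf_le1//.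
    have : 1 <= n%:R ^+ 2 :> R by rewrite expr_ge1// ler1n.
    by nra.
  by rewrite mulr_gt0// exprn_gt0.
rewrite CE -ler_pdivrMl//; apply: lb_le_inf.
  (* The infimum of the empty set would be 0, so a parallelogram with sides parallel to the axes is
     exhibited. *)
  have u1 : 1 ^+ 2 + 0 ^+ 2 = 1 :> R by rewrite expr1n expr0n addr0.
  have u2 : 0 ^+ 2 + 1 ^+ 2 = 1 :> R by rewrite expr1n expr0n add0r.
  have u3 : 1 * 1 - 0 * 0 != 0 :> R by rewrite mulr1 mulr0 subr0 oner_eq0.
  have [z [A [uA Ay DA vE]]] := exists_parallelogram diskD Ddisk Dy u1 u2 u3.
  by exists (Num.sqrt (affine_inv z A y 0 0 * affine_inv z A y 1 0) * `|\det A|), z, A.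
move=> _ [z [A [uA Ay DA ->]]].
rewrite ler_pdivrMl//.
have [f [sf f1 fI]] := parallelogram_peak compactD diskD Ddisk n0 uA DA tx t1 Dx deept.
by rewrite CE in fI; exact: le_trans (christoffel_le sf f1) fI.
Qed.

End Main.

(** The estimates close a cycle from [l] to [U / N], [L / N] and back to [l], so the three are
    comparable. *)
Lemma two_sided_bounds (R : realFieldType) (K C N L U l : R) :
  0 < K -> 0 < C -> 0 < N -> 0 <= l ->
  L <= K * N * l -> U <= 2048 * L -> l <= C * N^-1 * U ->
  (2048 * (K + C))^-1 * N^-1 * L <= l <= 2048 * (K + C) * N^-1 * L /\
  (2048 * (K + C))^-1 * N^-1 * U <= l <= 2048 * (K + C) * N^-1 * U.
Proof.
move=> K0 C0 N0 l0 LK UL lC.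
have M_gt0 : 0 < 2048 :> R by rewrite ltr0n.
have M_ge1 : 1 <= 2048 :> R by rewrite ler1n.
move: (2048 : R) M_gt0 M_ge1 UL => M M0 M1 UL.
have V0 : 0 < N^-1 by rewrite invr_gt0.
have LK' : N^-1 * L <= K * l by rewrite mulrC ler_pdivrMr// mulrAC.
have UL' : N^-1 * U <= M * (N^-1 * L) by rewrite mulrCA ler_pM2l.
have {}lC : l <= C * (N^-1 * U) by rewrite mulrA.
rewrite -![_^-1 * _ * _]mulrA -![_ * (K + C) * N^-1 * _]mulrA.
have S0 : 0 < K + C by exact: addr_gt0.
have M0' : 0 < M * (K + C) by exact: mulr_gt0.
move: (N^-1 * L) (N^-1 * U) LK' UL' lC => a b aK ba lb.
rewrite !ler_pdivrMl//.
have b0 : 0 <= b by rewrite -(pmulr_rge0 _ C0); exact: le_trans lb.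
have a0 : 0 <= a by rewrite -(pmulr_rge0 _ M0); exact: le_trans ba.
have Kl : K * l <= (K + C) * l by rewrite ler_wpM2r// lerDl ltW.
have Cb : C * b <= (K + C) * b by rewrite ler_wpM2r// lerDr ltW.
have Sl : (K + C) * l <= M * ((K + C) * l).
  by rewrite ler_peMl// mulr_ge0// ltW.
have Sb : (K + C) * b <= M * ((K + C) * b).
  by rewrite ler_peMl// mulr_ge0// ltW.
have Sab : (K + C) * b <= (K + C) * (M * a) by rewrite ler_pM2l.
have MK : M * a <= M * (K * l) by rewrite ler_pM2l.
have MKl : M * (K * l) <= M * ((K + C) * l) by rewrite ler_pM2l.
rewrite -!mulrA; split; apply/andP; split.
- exact: le_trans aK (le_trans Kl Sl).
- by rewrite mulrCA; exact: le_trans lb (le_trans Cb Sab).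
- exact: le_trans ba (le_trans MK MKl).
- exact: le_trans lb (le_trans Cb Sb).
Qed.

Theorem theorem3p1 (R : realType) :
  exists2 c : R, 0 < c &
    forall D : set 'cV[R]_2,
      convex_set D -> compact D -> disk R `<=` D -> D `<=` dilate 2 (disk R) ->
      forall (n : nat) (x : 'cV[R]_2), (1 <= n)%N -> D x ->
        c^-1 * n%:R ^- 2 * geomL (tau n D x) D <= christoffel n x D
          <= c * n%:R ^- 2 * geomL (tau n D x) D
        /\
        c^-1 * n%:R ^- 2 * geomU (tau n D x) D <= christoffel n x D
          <= c * n%:R ^- 2 * geomU (tau n D x) D.
Proof.
pose K : R := 128 * christoffel_const R ^+ 2; pose C : R := (800 * 117) ^+ 2.
have K0 : 0 < K.
  by apply: mulr_gt0; [rewrite ltr0n|rewrite exprn_gt0 ?christoffel_const_gt0].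
have C0 : 0 < C by apply: exprn_gt0; apply: mulr_gt0; rewrite ltr0n.
exists (2048 * (K + C)); first by apply: mulr_gt0 (addr_gt0 K0 C0); rewrite ltr0n.
move=> D convD compactD diskD Ddisk n x n0 Dx.
have [h1 h2] := christoffel_ge_geomL convD compactD diskD Ddisk n0 Dx.
have h3 := christoffel_le_geomU convD compactD diskD Ddisk n0 Dx.
have l0 : 0 <= christoffel n x D.
  by apply: christoffel_ge => f _ _; exact: integral2_sqr_ge0.
rewrite -/K in h1; rewrite -/C in h3.
have n2 : 0 < n%:R ^+ 2 :> R by rewrite exprn_gt0// ltr0n.
exact: two_sided_bounds K0 C0 n2 l0 h1 h2 h3.
Qed.
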